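(* Let $H$ be a colour Hopf algebra, let $A$ be a colour-commutative graded $H$-comodule colour algebra and let $M$ be a colour $(A,H)$-Hopf module. Assume that $B=A^{coH}$ is a colour division ring (for example, if $A$ is colour $H$-simple) and that there is a graded $H$-colinear map $\theta:H\to A$ which is a homomorphism of colour algebras. Then $M$ is graded free as a graded $A$-module, with rank equal to the rank of the graded $B$-module $M^{coH}$.
   Context: $\Bbbk$ is a field and $G$ is a multiplicative abelian group with identity $e$ and a bicharacter $(\cdot/\cdot):G\times G\to\Bbbk^{\times}$, i.e. $(g/g'g'')=(g/g')(g/g'')$ and $(gg'/g'')=(g/g'')(g'/g'')$. ''Graded'' means $G$-graded; $|m|$ is the degree of a homogeneous element $m$; formulas are written for homogeneous elements and extended linearly. A graded map $f:M\to N$ is a $\Bbbk$-linear map with $f(M_g)\subseteq N_g$ for all $g$. $\otimes=\otimes_{\Bbbk}$, graded by $(M\otimes N)_g=\bigoplus_{g'g''=g}M_{g'}\otimes N_{g''}$; $\Bbbk$ is in degree $e$. A colour algebra is a $G$-graded associative unital $\Bbbk$-algebra; it is colour-commutative if $ab=(|a|/|b|)ba$ for all homogeneous $a,b$; a homomorphism of colour algebras is a graded map that is a unital $\Bbbk$-algebra homomorphism. A colour division ring is a colour algebra in which every non-zero homogeneous element is invertible. A colour Hopf algebra $H$ is a colour algebra which is also a (coassociative, counital) coalgebra with graded maps $\Delta_H$, $\varepsilon_H$ (write $\Delta_H(h)=h_1\otimes h_2$ with homogeneous components), such that $\varepsilon_H$ is a unital algebra map, $\Delta_H(1_H)=1_H\otimes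 1_H$, $\Delta_H(hh')=(|h_2|/|h'_1|)\,h_1h'_1\otimes h_2h'_2$, and with a graded map $\mathcal S_H:H\to H$ (antipode) satisfying $h_1\mathcal S_H(h_2)=\varepsilon_H(h)1_H=\mathcal S_H(h_1)h_2$. A graded $H$-comodule is a graded vector space $M$ with a graded map $\chi_M:M\to H\otimes M$, $\chi_M(m)=m_{(-1)}\otimes m_{(0)}$, which is coassociative and counital (left comodule). $H$ is a graded $H$-comodule via $\Delta_H$. A graded $H$-colinear map is a graded map $f$ with $f(m)_{(-1)}\otimes f(m)_{(0)}=m_{(-1)}\otimes f(m_{(0)})$. Coinvariants: $M^{coH}=\{m\in M:\chi_M(m)=1_H\otimes m\}$, a graded subspace. A graded $H$-comodule colour algebra is a colour algebra $A$ that is a graded $H$-comodule with $\chi_A(1_A)=1_H\otimes 1_A$ and $\chi_A(aa')=(|a_{(0)}|/|a'_{(-1)}|)\,a_{(-1)}a'_{(-1)}\otimes a_{(0)}a'_{(0)}$. A graded $A$-module is a graded vector space that is a left $A$-module with $A_gM_{g'}\subseteq M_{gg'}$. A colour $(A,H)$-Hopf module is a graded $A$-module and graded $H$-comodule $M$ (same grading) with $\chi_M(am)=(|a_{(0)}|/|m_{(-1)}|)\,a_{(-1)}m_{(-1)}\otimes a_{(0)}m_{(0)}$. $B=A^{coH}$ is a graded subalgebra of $A$ and $M^{coH}$ is a graded left $B$-module. $A$ is colour $H$-simple if its only graded two-sided ideals $I$ with $\chi_A(I)\subseteq H\otimes I$ are $(0)$ and $A$. A graded module is graded free if it has a basis consisting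 of homogeneous elements; the rank is the cardinality of such a basis. Over a colour division ring every graded module is graded free and any two homogeneous bases have the same cardinality. *)

(* Defs.v *)
From HB Require Import structures.
From mathcomp Require Import all_boot all_algebra.
From mathcomp Require Import generic_quotient ring_quotient sesquilinear.
From mathcomp Require Import boolp classical_sets functions cardinality.
From mathcomp Require freeg.

Set Implicit Arguments.
Unset Strict Implicit.
Unset Printing Implicit Defensive.

Import GRing.Theory.

Local Open Scope classical_set_scope.
Local Open Scope ring_scope.
Local Open Scope quotient_scope.

Notation is_bilinear f := (bilinear_for *:%R *:%R f).

(* [tensor U V] is the free vector space on [U * V] modulo the subspace spanned
   by the bilinearity relations. *)

Section TensorDef.
Import freeg.
Variables (K : fieldType) (U V : lmodType K).

Local Notation free := {freeg (U * V)%type / K}.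
Local Notation gen u v := (<< (u, v) >> : free).

Inductive bilin_relation : free -> Prop :=
| BilinLeft a u u' v :
    bilin_relation (gen (a *: u + u') v - (a *: gen u v + gen u' v))
| BilinRight a u v v' :
    bilin_relation (gen u (a *: v + v') - (a *: gen u v + gen u v'))
| Bilin0 : bilin_relation 0
| BilinLinear a x y :
    bilin_relation x -> bilin_relation y -> bilin_relation (a *: x + y).

Definition bilin_pred : {pred free} := fun x => `[< bilin_relation x >].

Lemma bilin_predP x : reflect (bilin_relation x) (x \in bilin_pred).
Proof. by rewrite unfold_in; exact: asboolP. Qed.

Lemma bilin_predZ a x : x \in bilin_pred -> a *: x \in bilin_pred.
Proof.
move=> /bilin_predP x0; apply/bilin_predP.
by rewrite -[_ *: _]addr0; apply: BilinLinear => //; apply: Bilin0.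
Qed.

Fact bilin_zmod_closed : zmod_closed bilin_pred.
Proof.
split=> [|x y /bilin_predP x0 /bilin_predP y0]; apply/bilin_predP.
  exact: Bilin0.
by rewrite -scaleN1r addrC; apply: BilinLinear.
Qed.

HB.instance Definition _ := GRing.isZmodClosed.Build free bilin_pred
  bilin_zmod_closed.

Definition tensor := Quotient.quot (bilin_pred : zmodClosed free).
HB.instance Definition _ := GRing.Zmodule.on tensor.
HB.instance Definition _ := Quotient.on tensor.

Definition proj (x : free) : tensor := \pi_(tensor) x.

Lemma projE x y : (proj x = proj y) <-> (x - y \in bilin_pred).
Proof.
have E := @Quotient.idealrBE _ (bilin_pred : zmodClosed free) x y.
by split=> [/eqP|xy]; [rewrite -E | apply/eqP; rewrite -E].
Qed.

Lemma projB : {morph proj : x y / x - y}.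
Proof. by move=> x y; rewrite /proj !piE. Qed.

Lemma projD : {morph proj : x y / x + y}.
Proof. by move=> x y; rewrite /proj !piE. Qed.

Lemma repr_proj x : proj (repr x) = x.
Proof. exact: reprK. Qed.

Definition tscale (a : K) (x : tensor) : tensor := proj (a *: repr x).

Lemma tscaleE a x : tscale a (proj x) = proj (a *: x).
Proof.
by apply/projE; rewrite -scalerBr; apply/bilin_predZ/projE; rewrite repr_proj.
Qed.

Fact tscaleA a b x : tscale a (tscale b x) = tscale (a * b) x.
Proof. by rewrite -[x]repr_proj !tscaleE scalerA. Qed.
Fact tscale1 : left_id 1 tscale.
Proof. by move=> x; rewrite -[x]repr_proj !tscaleE scale1r. Qed.
Fact tscaleDr : right_distributive tscale +%R.
Proof.
move=> a x y; rewrite -[x]repr_proj -[y]repr_proj -projD !tscaleE.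
by rewrite scalerDr projD.
Qed.
Fact tscaleDl x : {morph tscale^~ x : a b / a + b}.
Proof. by move=> a b; rewrite -[x]repr_proj !tscaleE scalerDl projD. Qed.

HB.instance Definition _ := GRing.Zmodule_isLmodule.Build K tensor
  tscaleA tscale1 tscaleDr tscaleDl.

Lemma projZ a x : proj (a *: x) = a *: proj x.
Proof. by rewrite -tscaleE. Qed.

Definition tens (u : U) (v : V) : tensor := proj (gen u v).

Lemma tens_bilinear : is_bilinear tens.
Proof.
split=> [v a u u'|u a v v']; rewrite /= /tens -projZ -projD;
  apply/projE/bilin_predP; by constructor.
Qed.

(* The linear map induced by [f], when [f] is bilinear; no meaning otherwise. *)
Definition tlift (W : lmodType K) (f : U -> V -> W) (t : tensor) : W :=
  fglift (fun x => f x.1 x.2) (repr t).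

Section Lift.
Variables (W : lmodType K) (f : U -> V -> W).
Hypothesis fP : is_bilinear f.

Let F := fglift (fun x : U * V => f x.1 x.2).

Let F_add : {morph F : x y / x + y}.
Proof.
move=> x y.
have FB : {morph F : x y / x - y} by exact: lift_is_additive.
have F0 : F 0 = 0 by rewrite -[X in F X](subrr 0) FB subrr.
have FN z : F (- z) = - F z by rewrite -sub0r FB F0 sub0r.
by rewrite -[X in x + X]opprK FB FN opprK.
Qed.

Let F_scale a x : F (a *: x) = a *: F x.
Proof.
rewrite -[x]freeg_sumE scaler_sumr !(big_morph F F_add (id1 := 0)); last first.
- by apply: (addrI (F 0)); rewrite -F_add !addr0.
- by apply: (addrI (F 0)); rewrite -F_add !addr0.
rewrite scaler_sumr; apply: eq_bigr => z _; rewrite [in RHS]/F liftU scalerA.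
rewrite -(liftU (fun x => f x.1 x.2)); congr F.
apply/eqP/freeg_eqP => k; rewrite coeffZ !coeffU mulrA //.
Qed.

Let F_rel x : bilin_relation x -> F x = 0.
Proof.
have F1 u v : F (gen u v) = f u v by rewrite /F liftU scale1r.
have F_sub x' y : F (x' - y) = F x' - F y.
  by rewrite F_add -[- y]scaleN1r F_scale scaleN1r.
elim=> [a u u' v|a u v v'||a x' y _ IHx _ IHy].
- by rewrite F_sub F_add F_scale !F1 fP.1 subrr.
- by rewrite F_sub F_add F_scale !F1 fP.2 subrr.
- by rewrite -[X in F X](subrr 0) F_sub subrr.
- by rewrite F_add F_scale IHx IHy scaler0 addr0.
Qed.

Let tlift_proj x : tlift f (proj x) = F x.
Proof.
rewrite /tlift -/F; apply/eqP; rewrite -subr_eq0 -[- F x]scaleN1r -F_scale -F_add.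
by rewrite scaleN1r; apply/eqP/F_rel/bilin_predP/projE; rewrite repr_proj.
Qed.

Lemma tlift_linear : linear (tlift f).
Proof.
move=> a x y; rewrite -[x]repr_proj -[y]repr_proj -projZ -projD !tlift_proj.
by rewrite F_add F_scale.
Qed.

Lemma tliftE u v : tlift f (tens u v) = f u v.
Proof. by rewrite tlift_proj /F liftU scale1r. Qed.

End Lift.

Lemma tens_span (t : tensor) :
  exists s : seq (U * V), t = \sum_(x <- s) tens x.1 x.2.
Proof.
have projM : {morph proj : x y / x + y >-> x + y} by exact: projD.
have proj0 : proj 0 = 0 by rewrite -[X in proj X](subrr 0) projB subrr.
exists [seq (coeff z (repr t) *: z.1, z.2) | z <- dom (repr t)].
rewrite big_map -[t in LHS]repr_proj -{1}[repr t]freeg_sumE.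
rewrite (big_morph proj projM proj0); apply: eq_bigr => -[u v] _ /=.
have tZ a : tens (a *: u) v = a *: tens u v.
  have [lin _] := tens_bilinear; have /= lv := lin v.
  have t0 : tens 0 v = 0.
    have := lv 1 0 0; rewrite !scale1r addr0 => /eqP.
    by rewrite -subr_eq0 opprD addrA subrr sub0r oppr_eq0 => /eqP.
  by rewrite -[a *: u]addr0 lv t0 addr0.
rewrite tZ /tens -projZ; congr proj.
by apply/eqP/freeg_eqP => k; rewrite coeffZ !coeffU mulrA mulr1.
Qed.

End TensorDef.

Notation "U ⊗ V" := (tensor U%type V%type)
  (at level 40, left associativity) : type_scope.
Notation "u ⊗ v" := (tens u v)
  (at level 40, left associativity) : ring_scope.

Section TensorTheory.
Variables (K : fieldType) (U V W : lmodType K).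

Lemma linear_sum_fun (X Y : lmodType K) (f : X -> Y) I (r : seq I) (F : I -> X) :
  linear f -> f (\sum_(i <- r) F i) = \sum_(i <- r) f (F i).
Proof.
move=> fl; have f0 : f 0 = 0.
  by have /eqP := fl 1 0 0; rewrite !scale1r addr0 -subr_eq0 opprD addrA subrr
    sub0r oppr_eq0 => /eqP.
by apply: (big_morph f) => // x y; rewrite -[x]scale1r fl !scale1r.
Qed.

Lemma sum_linear (X Y : lmodType K) I (r : seq I) (f : I -> X -> Y) :
  (forall i, linear (f i)) -> linear (fun x => \sum_(i <- r) f i x).
Proof.
move=> fl a x y; rewrite scaler_sumr -big_split; apply: eq_bigr => i _.
exact: fl.
Qed.

Lemma tlift_sum (f : U -> V -> W) (s : seq (U * V)) : is_bilinear f ->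
  tlift f (\sum_(x <- s) x.1 ⊗ x.2) = \sum_(x <- s) f x.1 x.2.
Proof.
move=> fb; rewrite linear_sum_fun; last exact: tlift_linear.
by apply: eq_bigr => x _; rewrite tliftE.
Qed.

Lemma tensor_ext (f g : U ⊗ V -> W) : linear f -> linear g ->
  (forall u v, f (u ⊗ v) = g (u ⊗ v)) -> f =1 g.
Proof.
move=> fl gl fg t; have [s ->] := tens_span t.
by rewrite !linear_sum_fun //; apply: eq_bigr.
Qed.

End TensorTheory.

Section TensorMaps.
Variables (K : fieldType) (U V W U' V' : lmodType K).

Definition tmap (f : U -> U') (g : V -> V') : U ⊗ V -> U' ⊗ V' :=
  tlift (fun u v => f u ⊗ g v).

Definition tassoc : (U ⊗ V) ⊗ W -> U ⊗ (V ⊗ W) :=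
  tlift (fun t w => tlift (fun u v => u ⊗ (v ⊗ w)) t).

Lemma tmapE f g : linear f -> linear g ->
  forall u v, tmap f g (u ⊗ v) = f u ⊗ g v.
Proof.
move=> fl gl u v; rewrite /tmap tliftE //.
by split=> [y a x x'|x a y y'] /=; rewrite ?fl ?gl; apply tens_bilinear.
Qed.

Lemma tassocE u v w : tassoc ((u ⊗ v) ⊗ w) = u ⊗ (v ⊗ w).
Proof.
have b1 w' : is_bilinear (fun (x : U) (y : V) => x ⊗ (y ⊗ w')).
  split=> [y a x x'|x a y y'] /=; first by rewrite (tens_bilinear _ _).1.
  by rewrite (tens_bilinear _ _).1 (tens_bilinear _ _).2.
rewrite /tassoc tliftE ?tliftE //; split=> [w' a x x'|x a y y'] /=.
  exact: tlift_linear.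
have [s ->] := tens_span x; rewrite !tlift_sum // scaler_sumr -big_split /=.
by apply: eq_bigr => -[p q] _ /=; rewrite !(tens_bilinear _ _).2.
Qed.

End TensorMaps.

Record grading (K : fieldType) (G : groupType) (V : lmodType K) := Grading {
  piece :> G -> set V;
  piece0 : forall g, piece g 0;
  piece_linear : forall g a u v, piece g u -> piece g v -> piece g (a *: u + v);
  piece_span : forall v, exists (s : seq G) (c : G -> V),
    [/\ uniq s, forall g, piece g (c g) & v = \sum_(g <- s) c g];
  piece_indep : forall (s : seq G) (c : G -> V), uniq s ->
    (forall g, piece g (c g)) -> \sum_(g <- s) c g = 0 ->
    forall g, g \in s -> c g = 0
}.

Lemma big_sub_seq (I : eqType) (X : nmodType) (s t : seq I) (F : I -> X) :
  uniq s -> uniq t -> {subset s <= t} -> (forall i, i \notin s -> F i = 0) ->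
  \sum_(i <- s) F i = \sum_(i <- t) F i.
Proof.
move=> us ut st F0; rewrite [RHS](bigID (mem s)) /= [X in _ + X]big1 ?addr0;
  last by move=> i; exact: F0.
rewrite -[RHS]big_filter; apply/perm_big/uniq_perm; rewrite ?filter_uniq //.
by move=> i; rewrite mem_filter; case: (boolP (i \in s)) => // /st ->.
Qed.

Section Components.
Variables (K : fieldType) (G : groupType) (V : lmodType K) (D : grading G V).

Definition decomposition (v : V) : seq G * (G -> V) :=
  let: exist s sP := cid (piece_span D v) in (s, projT1 (cid sP)).

Definition gsupp (v : V) : seq G := (decomposition v).1.

(* The component of [v] of degree [g]; see [gcompE] and [gcomp_sum]. *)
Definition gcomp (g : G) (v : V) : V :=
  if g \in gsupp v then (decomposition v).2 g else 0.

Lemma decompositionP v : [/\ uniq (gsupp v), forall g, D g (gcomp g v)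
  & v = \sum_(g <- gsupp v) gcomp g v].
Proof.
have [us cD vE] : [/\ uniq (gsupp v), forall g, D g ((decomposition v).2 g)
    & v = \sum_(g <- gsupp v) (decomposition v).2 g].
  rewrite /gsupp /decomposition; case: cid => s sP /=; exact: (projT2 (cid sP)).
split=> // [g|]; first by rewrite /gcomp; case: ifP => // _; exact: piece0.
by rewrite {1}vE !big_seq; apply: eq_bigr => g gs; rewrite /gcomp gs.
Qed.

Lemma gcomp_piece g v : D g (gcomp g v). Proof. by case: (decompositionP v). Qed.

Lemma gcomp_supp g v : g \notin gsupp v -> gcomp g v = 0.
Proof. by rewrite /gcomp => /negPf->. Qed.

Lemma pieceZ g a u : D g u -> D g (a *: u).
Proof. by move=> Du; rewrite -[_ *: _]addr0; apply/piece_linear/piece0. Qed.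

Lemma pieceD g u v : D g u -> D g v -> D g (u + v).
Proof. by move=> Du Dv; rewrite -[u]scale1r; apply: piece_linear. Qed.

Lemma gcomp_uniq (s : seq G) (c : G -> V) v : uniq s ->
  (forall g, D g (c g)) -> (forall g, g \notin s -> c g = 0) ->
  v = \sum_(g <- s) c g -> forall g, gcomp g v = c g.
Proof.
move=> us cD c0 vE g; have [uv vD vE'] := decompositionP v.
pose t := undup (s ++ gsupp v).
have ut : uniq t by exact: undup_uniq.
have sub1 : {subset s <= t} by move=> h hs; rewrite mem_undup mem_cat hs.
have sub2 : {subset gsupp v <= t}.
  by move=> h hs; rewrite mem_undup mem_cat hs orbT.
have /(@piece_indep _ _ _ D _ _ ut) : \sum_(h <- t) (gcomp h v + -1 *: c h) = 0.
  rewrite big_split /= -(big_sub_seq uv ut sub2 (fun h => @gcomp_supp h v)) -vE'.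
  by rewrite -scaler_sumr -(big_sub_seq us ut sub1 c0) -vE scaleN1r subrr.
have dD h : D h (gcomp h v + -1 *: c h).
  by apply: pieceD; [exact: gcomp_piece | apply: pieceZ].
move=> /(_ dD) d0; case: (boolP (g \in t)) => [/d0 /eqP|gt].
  by rewrite scaleN1r subr_eq0 => /eqP.
rewrite gcomp_supp ?c0 //.
  by apply: contra gt; exact: sub1.
by apply: contra gt; exact: sub2.
Qed.

Lemma gcompE g h v : D g v -> gcomp h v = if h == g then v else 0.
Proof.
move=> Dv; apply: (@gcomp_uniq [:: g] (fun h => if h == g then v else 0)) => //.
- by move=> k; case: eqP => [->|_] //; exact: piece0.
- by move=> k; rewrite inE => /negPf->.
- by rewrite big_seq1 eqxx.
Qed.

Lemma gcomp_linear g : linear (gcomp g).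
Proof.
move=> a u v; have [uu uD uE] := decompositionP u.
have [uv vD vE] := decompositionP v.
pose t := undup (gsupp u ++ gsupp v).
have ut : uniq t by exact: undup_uniq.
apply: (@gcomp_uniq t (fun g => a *: gcomp g u + gcomp g v)) => // [h|h|].
- by apply: piece_linear; exact: gcomp_piece.
- rewrite mem_undup mem_cat negb_or => /andP[hu hv].
  by rewrite !gcomp_supp // scaler0 addr0.
rewrite big_split /= -scaler_sumr; congr (a *: _ + _).
- rewrite {1}uE; apply: big_sub_seq => // [h hs|h hs].
    by rewrite mem_undup mem_cat hs.
  by rewrite gcomp_supp.
- rewrite {1}vE; apply: big_sub_seq => // [h hs|h hs].
    by rewrite mem_undup mem_cat hs orbT.
  by rewrite gcomp_supp.
Qed.

Lemma gcomp_sum (t : seq G) v : uniq t -> {subset gsupp v <= t} ->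
  \sum_(g <- t) gcomp g v = v.
Proof.
move=> ut st; have [uv _ {2}->] := decompositionP v.
by symmetry; apply: big_sub_seq => // g; exact: gcomp_supp.
Qed.

End Components.

Definition graded_map (K : fieldType) (G : groupType) (U V : lmodType K)
    (DU : G -> set U) (DV : G -> set V) (f : U -> V) : Prop :=
  forall g u, DU g u -> DV g (f u).

(* The base field, placed in degree 1. *)
Definition base_piece (K : fieldType) (G : groupType) (g : G) : set K^o :=
  [set c | g = 1%g \/ c = 0].

Section TensorGrading.
Variables (K : fieldType) (G : groupType) (U V : lmodType K).
Variables (DU : grading G U) (DV : grading G V).

Definition tpiece (g : G) : set (U ⊗ V) := [set t | exists s : seq (U * V),
  (forall x, x \in s ->
     exists g' g'', [/\ (g' * g'')%g = g, DU g' x.1 & DV g'' x.2])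
  /\ t = \sum_(x <- s) x.1 ⊗ x.2].

Let tproj (p : G * G) : U ⊗ V -> U ⊗ V := tmap (gcomp DU p.1) (gcomp DV p.2).

Let tproj_linear p : linear (tproj p).
Proof.
apply: tlift_linear; split=> [v a u u'|u a v v'] /=;
  by rewrite gcomp_linear (tens_bilinear _ _).1 || by rewrite gcomp_linear (tens_bilinear _ _).2.
Qed.

Let tprojE p u v : tproj p (u ⊗ v) = gcomp DU p.1 u ⊗ gcomp DV p.2 v.
Proof. by apply: tmapE; exact: gcomp_linear. Qed.

Let tens0l (v : V) : (0 : U) ⊗ v = 0.
Proof.
have /= /eqP := (tens_bilinear U V).1 v 1 0 0.
by rewrite !scale1r addr0 -subr_eq0 opprD addrA subrr sub0r oppr_eq0 => /eqP.
Qed.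

Let tens0r (u : U) : u ⊗ (0 : V) = 0.
Proof.
have /= /eqP := (tens_bilinear U V).2 u 1 0 0.
by rewrite !scale1r addr0 -subr_eq0 opprD addrA subrr sub0r oppr_eq0 => /eqP.
Qed.

Let tens_suml (r : seq G) (F : G -> U) (v : V) :
  (\sum_(i <- r) F i) ⊗ v = \sum_(i <- r) F i ⊗ v.
Proof.
apply: (@linear_sum_fun K U (tensor U V) (fun u => u ⊗ v)).
exact: (tens_bilinear U V).1.
Qed.

Let tens_sumr (r : seq G) (F : G -> V) (u : U) :
  u ⊗ (\sum_(i <- r) F i) = \sum_(i <- r) u ⊗ F i.
Proof. apply: (@linear_sum_fun K V (tensor U V) (fun v => u ⊗ v)).
exact: (tens_bilinear U V).2. Qed.

Fact tpiece0 g : tpiece g 0.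
Proof. by exists [::]; rewrite big_nil; split=> // x. Qed.

Fact tpiece_linear g a t t' :
  tpiece g t -> tpiece g t' -> tpiece g (a *: t + t').
Proof.
move=> [s [sP ->]] [s' [sP' ->]].
exists ([seq (a *: x.1, x.2) | x <- s] ++ s'); split.
  move=> x; rewrite mem_cat => /orP[/mapP[y ys ->]|/sP'//] /=.
  by have [g' [g'' [gE y1 y2]]] := sP y ys; exists g', g''; split=> //; exact: pieceZ.
rewrite big_cat big_map scaler_sumr; congr (_ + _); apply: eq_bigr => x _ /=.
have := (tens_bilinear U V).1 x.2 a x.1 0.
by rewrite /= tens0l !addr0.
Qed.

Let tpieceP g (t : U ⊗ V) p : tpiece g t -> (p.1 * p.2)%g != g -> tproj p t = 0.
Proof.
move=> [s [sP ->]] pg; rewrite (linear_sum_fun _ _ (tproj_linear p)) big_seq big1 //.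
move=> x xs; rewrite tprojE.
have [g' [g'' [gE x1 x2]]] := sP x xs.
rewrite (gcompE _ x1) (gcompE _ x2); case: eqP => [e1|]; last by rewrite tens0l.
case: eqP => [e2|]; last by rewrite tens0r.
by rewrite e1 e2 gE eqxx in pg.
Qed.

Let tproj_piece (p : G * G) t : tpiece (p.1 * p.2)%g (tproj p t).
Proof.
have [s ->] := tens_span t; rewrite (linear_sum_fun _ _ (tproj_linear p)).
exists [seq (gcomp DU p.1 x.1, gcomp DV p.2 x.2) | x <- s]; split.
  by move=> x /mapP[y _ ->]; exists p.1, p.2; split=> //=; exact: gcomp_piece.
by rewrite big_map; apply: eq_bigr => x _; rewrite tprojE.
Qed.

Let tproj_decomp t : exists L : seq (G * G), t = \sum_(p <- L) tproj p t.
Proof.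
have [s tE] := tens_span t.
pose LU := undup (flatten [seq gsupp DU x.1 | x <- s]).
pose LV := undup (flatten [seq gsupp DV x.2 | x <- s]).
exists [seq (a, b) | a <- LU, b <- LV].
have -> : \sum_(p <- [seq (a, b) | a <- LU, b <- LV]) tproj p t =
    \sum_(x <- s) \sum_(p <- [seq (a, b) | a <- LU, b <- LV])
      gcomp DU p.1 x.1 ⊗ gcomp DV p.2 x.2.
  rewrite exchange_big /=; apply: eq_bigr => p _.
  rewrite tE (linear_sum_fun _ _ (tproj_linear p)).
  by apply: eq_bigr => x _; rewrite tprojE.
rewrite {1}tE !big_seq; apply: eq_bigr => x xs.
rewrite big_allpairs /=.
under eq_bigr do rewrite -tens_sumr.
rewrite -tens_suml !gcomp_sum ?undup_uniq // => g gx;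
  by rewrite mem_undup; apply/flattenP; eexists; [apply: map_f xs|].
Qed.

Fact tpiece_span t : exists (s : seq G) (c : G -> U ⊗ V),
  [/\ uniq s, forall g, tpiece g (c g) & t = \sum_(g <- s) c g].
Proof.
have [L tE] := tproj_decomp t.
exists (undup [seq (p.1 * p.2)%g | p <- L]),
  (fun g => \sum_(p <- L | (p.1 * p.2)%g == g) tproj p t).
split; first exact: undup_uniq.
  move=> g; apply: big_ind => [|x y|p /eqP <-]; [exact: tpiece0| |exact: tproj_piece].
  by move=> gx gy; rewrite -[x]scale1r; exact: tpiece_linear.
rewrite (exchange_big_dep xpredT) //= {1}tE !big_seq; apply: eq_bigr => p pL.
rewrite -big_filter (perm_big [:: (p.1 * p.2)%g]) ?big_seq1 //=.
apply: uniq_perm; rewrite ?filter_uniq ?undup_uniq // => g.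
rewrite inE mem_filter mem_undup eq_sym; case: eqP => //= ->.
by rewrite (map_f (fun p : G * G => (p.1 * p.2)%g) pL).
Qed.

Fact tpiece_indep (s : seq G) (c : G -> U ⊗ V) : uniq s ->
  (forall g, tpiece g (c g)) -> \sum_(g <- s) c g = 0 ->
  forall g, g \in s -> c g = 0.
Proof.
move=> us cP c0 g gs.
have [L ->] := tproj_decomp (c g); apply: big1 => p _.
case: (eqVneq (p.1 * p.2)%g g) => [pg|]; last exact: tpieceP.
have tp0 : tproj p 0 = 0.
  have := @linear_sum_fun _ _ _ _ _ [::] (fun x : U ⊗ V => x) (tproj_linear p).
  by rewrite !big_nil.
have /(congr1 (tproj p)) := c0.
rewrite (linear_sum_fun _ _ (tproj_linear p)) tp0 (bigD1_seq g) //= big1 ?addr0 //.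
by move=> h hg; apply: tpieceP (cP h) _; rewrite pg eq_sym.
Qed.

Definition tgrading : grading G (U ⊗ V)%type :=
  Grading tpiece0 tpiece_linear tpiece_span tpiece_indep.

End TensorGrading.

Section ColourMul.
Variables (K : fieldType) (G : groupType) (beta : G -> G -> K).
Variables (U V U' V' P Q : lmodType K).
Variables (DV : grading G V) (DU' : grading G U').
Variables (p : U -> U' -> P) (q : V -> V' -> Q).

Definition colour_mul_pure (u : U) (v : V) (u' : U') (v' : V') : P ⊗ Q :=
  \sum_(g <- gsupp DV v) \sum_(h <- gsupp DU' u')
    beta g h *: (p u (gcomp DU' h u') ⊗ q (gcomp DV g v) v').

(* [(u ⊗ v) (u' ⊗ v') = (|v| / |u'|) (u u') ⊗ (v v')], with [p] and [q] as
   products; see [colour_mulE]. *)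
Definition colour_mul (t : U ⊗ V) (t' : U' ⊗ V') : P ⊗ Q :=
  tlift (fun u v => tlift (colour_mul_pure u v) t') t.

Hypotheses (p_bil : is_bilinear p) (q_bil : is_bilinear q).

Let term g h u v u' v' :=
  beta g h *: (p u (gcomp DU' h u') ⊗ q (gcomp DV g v) v').

Let bil0l (X Y Z : lmodType K) (f : X -> Y -> Z) y : is_bilinear f -> f 0 y = 0.
Proof.
move=> fb; have /= /eqP := fb.1 y 1 0 0.
by rewrite !scale1r addr0 -subr_eq0 opprD addrA subrr sub0r oppr_eq0 => /eqP.
Qed.

Let bil0r (X Y Z : lmodType K) (f : X -> Y -> Z) x : is_bilinear f -> f x 0 = 0.
Proof.
move=> fb; have /= /eqP := fb.2 x 1 0 0.
by rewrite !scale1r addr0 -subr_eq0 opprD addrA subrr sub0r oppr_eq0 => /eqP.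
Qed.

Let tens_bil := tens_bilinear P Q.

Let pure_widen (s s' : seq G) u v u' v' : uniq s -> uniq s' ->
  {subset gsupp DV v <= s} -> {subset gsupp DU' u' <= s'} ->
  colour_mul_pure u v u' v' = \sum_(g <- s) \sum_(h <- s') term g h u v u' v'.
Proof.
move=> us us' ss ss'; have [uv _ _] := decompositionP DV v.
have [uu _ _] := decompositionP DU' u'.
rewrite /colour_mul_pure (big_sub_seq uv us ss) => [|g gv].
  apply: eq_bigr => g _; apply: big_sub_seq => // h hu.
  by rewrite (gcomp_supp hu) (bil0r _ p_bil) (bil0l _ tens_bil) scaler0.
rewrite big1 // => h _.
by rewrite (gcomp_supp gv) (bil0l _ q_bil) (bil0r _ tens_bil) scaler0.
Qed.

Let pure_common u v1 v2 v3 u1 u2 u3 : exists s s' : seq G,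
  forall v u' v', v \in [:: v1; v2; v3] -> u' \in [:: u1; u2; u3] ->
  colour_mul_pure u v u' v' = \sum_(g <- s) \sum_(h <- s') term g h u v u' v'.
Proof.
exists (undup (flatten [seq gsupp DV v | v <- [:: v1; v2; v3]])),
  (undup (flatten [seq gsupp DU' u | u <- [:: u1; u2; u3]])) => v u' v' vs us.
by apply: pure_widen; rewrite ?undup_uniq // => g gs; rewrite mem_undup;
  apply/flattenP; eexists; [apply/map_f; eassumption | | apply/map_f; eassumption|].
Qed.

Let pure_linear1 v u' v' : linear (fun u => colour_mul_pure u v u' v').
Proof.
move=> a x y; rewrite /colour_mul_pure scaler_sumr -big_split /=.
apply: eq_bigr => g _; rewrite scaler_sumr -big_split /=; apply: eq_bigr => h _.
by rewrite p_bil.1 tens_bil.1 scalerDr !scalerA mulrC.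
Qed.

Let pure_linear2 u u' v' : linear (fun v => colour_mul_pure u v u' v').
Proof.
move=> a x y; have [s [s' E]] := pure_common u (a *: x + y) x y u' u' u'.
rewrite !E ?inE ?eqxx ?orbT // scaler_sumr -big_split /=.
apply: eq_bigr => g _; rewrite scaler_sumr -big_split /=; apply: eq_bigr => h _.
by rewrite /term gcomp_linear q_bil.1 tens_bil.2 scalerDr !scalerA mulrC.
Qed.

Let pure_bilinear u v : is_bilinear (colour_mul_pure u v).
Proof.
split=> [v' a x y|u' a x y] /=.
  have [s [s' E]] := pure_common u v v v (a *: x + y) x y.
  rewrite !E ?inE ?eqxx ?orbT // scaler_sumr -big_split /=.
  apply: eq_bigr => g _; rewrite scaler_sumr -big_split /=.
  apply: eq_bigr => h _.
  by rewrite /term gcomp_linear p_bil.2 tens_bil.1 scalerDr !scalerA mulrC.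
rewrite /colour_mul_pure scaler_sumr -big_split /=.
apply: eq_bigr => g _; rewrite scaler_sumr -big_split /=; apply: eq_bigr => h _.
by rewrite q_bil.2 tens_bil.2 scalerDr !scalerA mulrC.
Qed.

Let lift_bilinear t' : is_bilinear (fun u v => tlift (colour_mul_pure u v) t').
Proof.
have [s ->] := tens_span t'; split=> [v a x y|u a x y] /=;
  rewrite !tlift_sum // scaler_sumr -big_split; apply: eq_bigr => z _ /=.
  exact: pure_linear1.
exact: pure_linear2.
Qed.

Lemma colour_mul_bilinear : is_bilinear colour_mul.
Proof.
split=> [t' a x y|t a x y]; first exact/tlift_linear/lift_bilinear.
have [s ->] := tens_span t.
rewrite /colour_mul !(tlift_sum _ (lift_bilinear _)).
have pl (z : U * V) : linear (tlift (colour_mul_pure z.1 z.2)).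
  exact/tlift_linear/pure_bilinear.
exact: (sum_linear s pl a x y).
Qed.

Lemma colour_mulE g h u v u' v' : DV g v -> DU' h u' ->
  colour_mul (u ⊗ v) (u' ⊗ v') = beta g h *: (p u u' ⊗ q v v').
Proof.
move=> gv hu; rewrite /colour_mul !tliftE //.
have supp1 (k : G) (r : seq G) : exists s,
    [/\ uniq s, k \in s & {subset r <= s}].
  exists (undup (k :: r)); split; rewrite ?undup_uniq ?mem_undup ?mem_head //.
  by move=> l lr; rewrite mem_undup inE lr orbT.
have [s [us gs ss]] := supp1 g (gsupp DV v).
have [s' [us' hs ss']] := supp1 h (gsupp DU' u').
rewrite (pure_widen _ _ us us' ss ss') (bigD1_seq g) //= [X in _ + X]big1.
  rewrite addr0 (bigD1_seq h) //= big1 ?addr0 /term.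
    by rewrite (gcompE _ gv) (gcompE _ hu) !eqxx.
  move=> k /negPf kh; rewrite (gcompE _ hu) kh (bil0r _ p_bil).
  by rewrite (bil0l _ tens_bil) scaler0.
move=> k /negPf kg; apply: big1 => l _; rewrite /term (gcompE _ gv) kg.
by rewrite (bil0l _ q_bil) (bil0r _ tens_bil) scaler0.
Qed.

End ColourMul.

(* [beta g h] is [(g / h)]. *)
Definition bicharacter (K : fieldType) (G : groupType) (beta : G -> G -> K)
    : Prop :=
  [/\ forall g h, beta g h != 0,
      forall g h k, beta g (h * k)%g = beta g h * beta g k
    & forall g h k, beta (g * h)%g k = beta g k * beta h k].

Record colour_algebra (K : fieldType) (G : groupType) (A : algType K) :=
  ColourAlgebra {
  calg_grading :> grading G A;
  calg_one : calg_grading 1%g 1;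
  calg_mul : forall g h a b,
    calg_grading g a -> calg_grading h b -> calg_grading (g * h)%g (a * b)
}.

Definition colour_commutative (K : fieldType) (G : groupType)
    (beta : G -> G -> K) (A : algType K) (cA : colour_algebra G A) : Prop :=
  forall g h a b, cA g a -> cA h b -> a * b = beta g h *: (b * a).

(* To be used when [R] is a graded subalgebra of [A], with pieces [R `&` cA g].
   An [algType] is non-zero, hence so is [R]. *)
Definition colour_division_ring (K : fieldType) (G : groupType) (A : algType K)
    (cA : colour_algebra G A) (R : set A) : Prop :=
  forall g b, R b -> cA g b -> b <> 0 ->
    exists2 b', R b' & b * b' = 1 /\ b' * b = 1.

Record colour_hopf_algebra (K : fieldType) (G : groupType)
    (beta : G -> G -> K) (H : algType K) := ColourHopfAlgebra {
  hopf_calg :> colour_algebra G H;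
  hopf_comul : {linear H -> (H ⊗ H)%type};
  hopf_counit : {linear H -> K^o};
  hopf_antipode : {linear H -> H};
  hopf_comul_graded : graded_map hopf_calg (tgrading hopf_calg hopf_calg) hopf_comul;
  hopf_counit_graded : graded_map hopf_calg (@base_piece K G) hopf_counit;
  hopf_antipode_graded : graded_map hopf_calg hopf_calg hopf_antipode;
  hopf_coassoc : forall h,
    tassoc (tmap hopf_comul idfun (hopf_comul h)) =
    tmap idfun hopf_comul (hopf_comul h);
  hopf_counitl : forall h,
    tlift (fun x y : H => (hopf_counit x : K) *: y) (hopf_comul h) = h;
  hopf_counitr : forall h,
    tlift (fun x y : H => (hopf_counit y : K) *: x) (hopf_comul h) = h;
  hopf_counit1 : hopf_counit 1 = 1;
  hopf_counitM : forall h h',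
    hopf_counit (h * h') = hopf_counit h * hopf_counit h';
  hopf_comul1 : hopf_comul 1 = 1 ⊗ 1;
  hopf_comulM : forall h h', hopf_comul (h * h') =
    colour_mul beta hopf_calg hopf_calg *%R *%R (hopf_comul h) (hopf_comul h');
  hopf_antipoder : forall h,
    tlift (fun x y => x * hopf_antipode y) (hopf_comul h) =
    (hopf_counit h : K) *: 1;
  hopf_antipodel : forall h,
    tlift (fun x y => hopf_antipode x * y) (hopf_comul h) =
    (hopf_counit h : K) *: 1
}.

Section Comodules.
Variables (K : fieldType) (G : groupType) (beta : G -> G -> K).
Variables (H : algType K) (cH : colour_hopf_algebra beta H).

Record comodule (M : lmodType K) (D : grading G M) := Comodule {
  coact : {linear M -> (H ⊗ M)%type};
  coact_graded : graded_map D (tgrading cH D) coact;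
  coact_coassoc : forall m,
    tassoc (tmap (hopf_comul cH) idfun (coact m)) = tmap idfun coact (coact m);
  coact_counit : forall m,
    tlift (fun (h : H) (n : M) => (hopf_counit cH h : K) *: n) (coact m) = m
}.

Definition regular_comodule : comodule cH :=
  Comodule (hopf_comul_graded (c := cH)) (hopf_coassoc cH) (hopf_counitl cH).

Definition colinear (M N : lmodType K) (DM : grading G M) (DN : grading G N)
    (cM : comodule DM) (cN : comodule DN) (f : M -> N) : Prop :=
  forall m, coact cN (f m) = tmap idfun f (coact cM m).

Definition coinvariants (M : lmodType K) (D : grading G M) (cM : comodule D)
    : set M := [set m | coact cM m = 1 ⊗ m].

Record comodule_colour_algebra (A : algType K) := ComoduleColourAlgebra {
  cca_calg :> colour_algebra G A;
  cca_comodule :> comodule cca_calg;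
  cca_coact1 : coact cca_comodule 1 = 1 ⊗ 1;
  cca_coactM : forall a a', coact cca_comodule (a * a') =
    colour_mul beta cca_calg cH *%R *%R
      (coact cca_comodule a) (coact cca_comodule a')
}.

Definition graded_ideal (A : algType K) (cA : colour_algebra G A) (I : set A)
    : Prop :=
  [/\ I 0, forall x y, I x -> I y -> I (x + y),
      forall a x, I x -> I (a * x), forall a x, I x -> I (x * a)
    & forall g x, I x -> I (gcomp cA g x)].

Definition colour_simple (A : algType K) (cA : comodule_colour_algebra A)
    : Prop :=
  forall I : set A, graded_ideal cA I ->
    (forall x, I x -> exists s : seq (H * A),
      (forall y, y \in s -> I y.2) /\ coact cA x = \sum_(y <- s) y.1 ⊗ y.2) ->
    I = [set 0] \/ I = setT.

Record graded_module (A : algType K) (cA : colour_algebra G A)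
    (M : lmodType K) := GradedModule {
  gmod_grading :> grading G M;
  act : A -> M -> M;
  act_bilinear : is_bilinear act;
  act1 : forall m, act 1 m = m;
  actM : forall a b m, act (a * b) m = act a (act b m);
  act_graded : forall g h a m,
    cA g a -> gmod_grading h m -> gmod_grading (g * h)%g (act a m)
}.

Record hopf_module (A : algType K) (cA : comodule_colour_algebra A)
    (M : lmodType K) := HopfModule {
  hmod_gmod :> graded_module cA M;
  hmod_comodule :> comodule hmod_gmod;
  hmod_coact : forall a m, coact hmod_comodule (act hmod_gmod a m) =
    colour_mul beta cA cH *%R (act hmod_gmod)
      (coact cA a) (coact hmod_comodule m)
}.

(* [X] is a basis, made of homogeneous elements, of [N] as a module over [R],
   where [R] is a subalgebra of [A] and [N] is an additive subgroup of [M]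
   stable under [R]. *)
Definition homogeneous_basis (A : algType K) (cA : colour_algebra G A)
    (M : lmodType K) (gM : graded_module cA M) (R : set A) (N X : set M)
    : Prop :=
  [/\ X `<=` N,
      forall x, X x -> exists g, gM g x,
      forall n, N n -> exists (s : seq M) (c : M -> A),
        [/\ forall x, x \in s -> X x, forall x, R (c x)
          & n = \sum_(x <- s) act gM (c x) x]
    & forall (s : seq M) (c : M -> A), uniq s ->
        (forall x, x \in s -> X x) -> (forall x, R (c x)) ->
        \sum_(x <- s) act gM (c x) x = 0 -> forall x, x \in s -> c x = 0].

Definition graded_free (A : algType K) (cA : colour_algebra G A)
    (M : lmodType K) (gM : graded_module cA M) (R : set A) (N : set M) : Prop :=
  exists X, homogeneous_basis gM R N X.

(* The homogeneous bases of [N] over [R] and those of [N'] over [R'] all have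
   the same cardinality. *)
Definition same_rank (A : algType K) (cA : colour_algebra G A)
    (M : lmodType K) (gM : graded_module cA M) (R R' : set A) (N N' : set M)
    : Prop :=
  forall X X', homogeneous_basis gM R N X -> homogeneous_basis gM R' N' X' ->
    (X #= X')%card.

End Comodules.

(* Main.v *)
(* The antipode gives a graded projection p(m) = theta(S(m_(-1))) m_(0) of M onto
   its coinvariants N, with m = theta(m_(-1)) p(m_(0)) and
   p(theta(h) n) = epsilon(h) n for n in N.  Over the colour division ring
   B = A^coH, Zorn's lemma gives a homogeneous basis X of N.  The coordinate maps
   c_x of N extend to the left inverse m |-> theta(m_(-1)) c_x(p(m_(0))) on M, so
   that X is a basis of M over A.  On A, p is a ring retraction onto B and
   p(a m) = p(a) p(m) on M, so p maps any homogeneous basis of M over A bijectively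
   onto one of N over B; this reduces the equality of ranks to the exchange
   argument over B. *)
Require Import Defs.
From mathcomp Require Import all_boot all_algebra.
From mathcomp Require Import boolp classical_sets cardinality.

Set Implicit Arguments.
Unset Strict Implicit.
Unset Printing Implicit Defensive.

Import GRing.Theory.
Local Open Scope classical_set_scope.
Local Open Scope ring_scope.

(** * Tensors and the colour product *)

Section LinearMaps.
Variables (K : fieldType) (U V W X : lmodType K).

Lemma linear_fun0 (f : U -> V) : linear f -> f 0 = 0.
Proof.
by move=> fl; have := linear_sum_fun [::] (fun x : U => x) fl; rewrite !big_nil.
Qed.

Lemma linear_funD (f : U -> V) : linear f -> {morph f : x y / x + y}.
Proof. by move=> fl x y; rewrite -[x]scale1r fl !scale1r. Qed.

Lemma linear_funZ (f : U -> V) a : linear f -> {morph f : x / a *: x}.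
Proof. by move=> fl x; rewrite -[a *: x]addr0 fl (linear_fun0 fl) addr0. Qed.

Lemma linear_fun_comp (f : U -> V) (g : V -> W) :
  linear f -> linear g -> linear (fun x => g (f x)).
Proof. by move=> fl gl a x y; rewrite fl gl. Qed.

Lemma bilinear_comp (U' V' : lmodType K) (k : U -> V -> W) (f : U' -> U)
    (g : V' -> V) (h : W -> X) : is_bilinear k -> linear f -> linear g ->
  linear h -> is_bilinear (fun x y => h (k (f x) (g y))).
Proof.
by move=> kb fl gl hl; split=> [y a x x'|x a y y'] /=;
  [rewrite fl kb.1 | rewrite gl kb.2]; rewrite /= hl.
Qed.

Lemma linear_id : linear (fun x : U => x).
Proof. by []. Qed.

End LinearMaps.

Section TensorLift.
Variables (K : fieldType) (U V W : lmodType K).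

Lemma eq_tlift (f g : U -> V -> W) : (forall u v, f u v = g u v) ->
  tlift f =1 tlift g.
Proof. by move=> fg t; congr tlift; apply/funext => u; apply/funext. Qed.

Lemma linear_tlift (X : lmodType K) (L : W -> X) (f : U -> V -> W) t :
  linear L -> is_bilinear f -> L (tlift f t) = tlift (fun u v => L (f u v)) t.
Proof.
move=> Ll fb; have [s ->] := tens_span t.
rewrite !tlift_sum ?linear_sum_fun //.
exact: (bilinear_comp fb (@linear_id _ _) (@linear_id _ _) Ll).
Qed.

End TensorLift.

Section TensorMap.
Variables (K : fieldType) (U V W : lmodType K).

Lemma tmap_linear (U' V' : lmodType K) (f : U -> U') (g : V -> V') :
  linear f -> linear g -> linear (tmap f g).
Proof.
move=> fl gl; apply: tlift_linear.
exact: (bilinear_comp (tens_bilinear _ _) fl gl (@linear_id _ _)).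
Qed.

Lemma tlift_tmap (U' V' : lmodType K) (f : U -> U') (g : V -> V')
    (k : U' -> V' -> W) t : linear f -> linear g -> is_bilinear k ->
  tlift k (tmap f g t) = tlift (fun u v => k (f u) (g v)) t.
Proof.
move=> fl gl kb; rewrite /tmap (linear_tlift (L := tlift k)); first last.
- exact: (bilinear_comp (tens_bilinear _ _) fl gl (@linear_id _ _)).
- exact: tlift_linear.
by apply: eq_tlift => u v; rewrite tliftE.
Qed.

Lemma tlift_tens (t : U ⊗ V) : tlift (@tens K U V) t = t.
Proof.
by have [s ->] := tens_span t; rewrite tlift_sum //; exact: tens_bilinear.
Qed.

End TensorMap.

Definition trilinear (K : fieldType) (U V W X : lmodType K)
    (k : U -> V -> W -> X) :=
  (forall u, is_bilinear (k u)) /\ (forall v w, linear (fun u => k u v w)).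

Section TensorAssoc.
Variables (K : fieldType) (U V W X : lmodType K) (k : U -> V -> W -> X).
Hypothesis kt : trilinear k.

Lemma trilinear_lift : is_bilinear (fun u t => tlift (k u) t).
Proof.
split=> [t a u u'|u a t t'] /=; last exact: (tlift_linear (kt.1 u)).
have [s ->] := tens_span t; rewrite !tlift_sum; try exact: kt.1.
exact: (sum_linear s (fun x => kt.2 x.1 x.2) a u u').
Qed.

Lemma trilinear_liftl : is_bilinear (fun t w => tlift (fun u v => k u v w) t).
Proof.
have kb w : is_bilinear (fun u v => k u v w).
  by split=> [v|u]; [exact: (kt.2 v w) | exact: ((kt.1 u).1 w)].
split=> [w|t a w w'] /=; first exact: (tlift_linear (kb w)).
have [s ->] := tens_span t; rewrite !tlift_sum //.
exact: (sum_linear s (fun x => (kt.1 x.1).2 x.2) a w w').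
Qed.

(** Turns [tassoc] into a regrouping of iterated sums, the form in which coassociativity is applied
    to an arbitrary trilinear expression. *)
Lemma tlift_tassoc x :
  tlift (fun u t => tlift (k u) t) (tassoc x) =
  tlift (fun t w => tlift (fun u v => k u v w) t) x.
Proof.
have tb := @tens_bilinear K.
have at_ : trilinear (fun (u : U) (v : V) (w : W) => u ⊗ (v ⊗ w)).
  split=> [u|v w]; last exact: ((tb U (tensor V W)).1 (v ⊗ w)).
  by split=> [w a v v'|v a w w'] /=;
    rewrite ?(tb _ _).1 ?(tb _ _).2 /= ?(tb _ _).1 ?(tb _ _).2.
have bw (w : W) : is_bilinear (fun (u : U) (v : V) => u ⊗ (v ⊗ w)).
  by split=> [v|u]; [exact: (at_.2 v w) | exact: ((at_.1 u).1 w)].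
have al : linear (@tassoc K U V W).
  apply: tlift_linear; split=> [w|t a w w'] /=; first exact: (tlift_linear (bw w)).
  have [s ->] := tens_span t; rewrite !tlift_sum //.
  exact: (sum_linear s (fun x => (at_.1 x.1).2 x.2) a w w').
move: x; apply: tensor_ext => [||t w].
- exact: linear_fun_comp al (tlift_linear trilinear_lift).
- exact: (tlift_linear trilinear_liftl).
rewrite [RHS](tliftE trilinear_liftl).
move: t; apply: tensor_ext => [||u v].
- apply: (@linear_fun_comp _ _ _ _ (fun t => tassoc (t ⊗ w)))
    (tlift_linear trilinear_lift).
  exact: linear_fun_comp ((tb _ _).1 w) al.
- exact: (trilinear_liftl.1 w).
rewrite tassocE (tliftE trilinear_lift) (tliftE (kt.1 u)) tliftE //.
by split=> [v'|u']; [exact: (kt.2 v' w) | exact: ((kt.1 u').1 w)].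
Qed.

End TensorAssoc.

Section HomogeneousTensors.
Variables (K : fieldType) (G : groupType) (U V : lmodType K).
Variables (DU : grading G U) (DV : grading G V).

Lemma tens_span_homogeneous (t : U ⊗ V) : exists s : seq (U * V),
  (forall x, x \in s -> (exists g, DU g x.1) /\ (exists g, DV g x.2)) /\
  t = \sum_(x <- s) x.1 ⊗ x.2.
Proof.
have [s [c [_ cP ->]]] := piece_span (tgrading DU DV) t.
elim: s => [|g s [s1 [s1P IH]]]; first by exists [::]; rewrite !big_nil.
rewrite big_cons IH; have [s2 [s2P ->]] := cP g.
exists (s2 ++ s1); rewrite big_cat; split=> // x; rewrite mem_cat => /orP[|/s1P//].
by move=> /s2P[g1 [g2 [_ x1 x2]]]; split; [exists g1 | exists g2].
Qed.

(** [colour_mulE] evaluates the colour product on homogeneous factors, so identities for it are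
    tested on tensors of homogeneous elements. *)
Lemma tensor_ext_homogeneous (W : lmodType K) (f f' : U ⊗ V -> W) :
  linear f -> linear f' ->
  (forall g h u v, DU g u -> DV h v -> f (u ⊗ v) = f' (u ⊗ v)) -> f =1 f'.
Proof.
move=> fl fl' ff t; have [s [sP ->]] := tens_span_homogeneous t.
rewrite !linear_sum_fun // !big_seq; apply: eq_bigr => x /sP[[g xg] [h xh]].
exact: ff xg xh.
Qed.

Lemma homogeneous_ext (W : lmodType K) (f f' : U -> W) : linear f -> linear f' ->
  (forall g u, DU g u -> f u = f' u) -> f =1 f'.
Proof.
move=> fl fl' ff u; have [s [c [_ cP ->]]] := piece_span DU u.
by rewrite !linear_sum_fun //; apply: eq_bigr => g _; exact: ff (cP g).
Qed.

Lemma piece_sum g I (r : seq I) (P : pred I) (F : I -> U) :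
  (forall i, P i -> DU g (F i)) -> DU g (\sum_(i <- r | P i) F i).
Proof. by move=> FP; apply: big_ind => //; [exact: piece0 | exact: pieceD]. Qed.

Lemma gcomp_graded (f : U -> V) g u : linear f -> graded_map DU DV f ->
  gcomp DV g (f u) = f (gcomp DU g u).
Proof.
move=> fl fg; apply: (homogeneous_ext
  (linear_fun_comp fl (gcomp_linear DV g)) (linear_fun_comp (gcomp_linear DU g) fl)).
move=> h v hv; rewrite (gcompE _ (fg _ _ hv)) (gcompE _ hv).
by case: ifP => // _; rewrite linear_fun0.
Qed.

End HomogeneousTensors.

Section ColourProduct.
Variables (K : fieldType) (G : groupType).
Variables (beta : G -> G -> K) (beta_bichar : bicharacter beta).

Lemma bichar1r g : beta g 1%g = 1.
Proof.
have [b0 br _] := beta_bichar; apply: (mulfI (b0 g 1%g)).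
by rewrite -br mulg1 mulr1.
Qed.

Lemma bichar1l g : beta 1%g g = 1.
Proof.
have [b0 _ bl] := beta_bichar; apply: (mulfI (b0 1%g g)).
by rewrite -bl mulg1 mulr1.
Qed.

Variables (H A : algType K) (cH : colour_algebra G H) (cA : colour_algebra G A).
Variables (M : lmodType K) (gM : graded_module cA M).

Lemma mul_bilinear (R : algType K) : is_bilinear (@GRing.mul R).
Proof.
by split=> [y a x x'|x a y y'] /=; rewrite ?mulrDl ?mulrDr -?scalerAl -?scalerAr.
Qed.

Let mulA := colour_mul beta cA cH *%R *%R.
Let mulM := colour_mul beta cA cH *%R (act gM).
Let mulA_bil := colour_mul_bilinear beta cA cH (mul_bilinear H) (mul_bilinear A).
Let mulM_bil := colour_mul_bilinear beta cA cH (mul_bilinear H) (act_bilinear gM).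

Lemma colour_mul_1tens (t : H ⊗ A) (m : M) :
  mulM t (1 ⊗ m) = tmap idfun (fun a => act gM a m) t.
Proof.
have actl : linear (fun a => act gM a m) := (act_bilinear gM).1 m.
move: t; apply: (tensor_ext_homogeneous (DU := cH) (DV := cA)).
- exact: mulM_bil.1.
- exact: tmap_linear.
move=> g h u v ug vh; rewrite tmapE //.
rewrite /mulM (colour_mulE _ (mul_bilinear _) (act_bilinear _) _ _ vh (calg_one cH)).
by rewrite bichar1r scale1r mulr1.
Qed.

Lemma colour_mul1 (t : H ⊗ M) : mulM (1 ⊗ 1) t = t.
Proof.
move: t; apply: (tensor_ext_homogeneous (DU := cH) (DV := gM)).
- exact: mulM_bil.2.
- by [].
move=> g h u v ug vh.
rewrite /mulM (colour_mulE _ (mul_bilinear _) (act_bilinear _) _ _ (calg_one cA) ug).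
by rewrite bichar1l scale1r mul1r act1.
Qed.

(** With h, h' the degrees of a, b and g', g2 those of y, z, both sides carry the scalar
    (h/g')(h/g2)(h'/g2), by multiplicativity of the bicharacter in each argument. Together with
    [colour_mul1] this makes H ⊗ M a module over H ⊗ A. *)
Lemma colour_mulA (t t' : H ⊗ A) (t'' : H ⊗ M) :
  mulM (mulA t t') t'' = mulM t (mulM t' t'').
Proof.
have [b0 br bl] := beta_bichar.
move: t; apply: (tensor_ext_homogeneous (DU := cH) (DV := cA)).
- exact: linear_fun_comp (mulA_bil.1 t') (mulM_bil.1 t'').
- exact: mulM_bil.1.
move=> g h x a xg ah.
move: t'; apply: (tensor_ext_homogeneous (DU := cH) (DV := cA)).
- exact: linear_fun_comp (mulA_bil.2 _) (mulM_bil.1 t'').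
- exact: linear_fun_comp (mulM_bil.1 _) (mulM_bil.2 _).
move=> g' h' y b yg bh.
move: t''; apply: (tensor_ext_homogeneous (DU := cH) (DV := gM)).
- exact: mulM_bil.2.
- exact: linear_fun_comp (mulM_bil.2 _) (mulM_bil.2 _).
move=> g2 h2 z m zg mh.
have E := fun u v u' v' => colour_mulE beta (mul_bilinear H) (act_bilinear gM)
  u (v := v) (u' := u') v'.
have E' := fun u v u' v' => colour_mulE beta (mul_bilinear H) (mul_bilinear A)
  u (v := v) (u' := u') v'.
rewrite /mulA (E' _ _ _ _ _ _ _ _ ah yg) /mulM.
rewrite (linear_funZ _ (mulM_bil.1 _)) (E _ _ _ _ _ _ _ _ (calg_mul ah bh) zg).
rewrite (E _ _ _ _ _ _ _ _ bh zg) (linear_funZ _ (mulM_bil.2 _)).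
rewrite (E _ _ _ _ _ _ _ _ ah (calg_mul yg zg)) !scalerA mulrA actM; congr (_ *: _).
by rewrite bl br mulrA mulrC.
Qed.

End ColourProduct.

(** * Convolution and coinvariants *)

Section Convolution.
Variables (K : fieldType) (G : groupType) (beta : G -> G -> K).
Variables (H : algType K) (cH : colour_hopf_algebra beta H).
Variables (M : lmodType K) (D : grading G M) (cM : comodule cH D).

(** Coassociativity in Sweedler form: both sides are the sum of k(m_(-2), m_(-1), m_(0)). *)
Lemma coact_trilinear (W : lmodType K) (k : H -> H -> M -> W) m :
  trilinear k ->
  tlift (fun h n => tlift (k h) (coact cM n)) (coact cM m) =
  tlift (fun h n => tlift (fun h1 h2 => k h1 h2 n) (hopf_comul cH h)) (coact cM m).
Proof.
move=> kt; have lin_co : linear (coact cM) by exact: linearP.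
have lin_comul : linear (hopf_comul cH) by exact: linearP.
rewrite -(tlift_tmap (f := idfun) (g := coact cM) _ _ lin_co (trilinear_lift kt)) //.
rewrite -coact_coassoc tlift_tassoc //.
by rewrite (tlift_tmap _ lin_comul _ (trilinear_liftl kt)).
Qed.

Variable W : lmodType K.

(** When [r] is an action of H on W, this is the action of an element of the convolution algebra
    Hom(H, End W) on Hom(M, W). *)
Definition convolution (r : H -> W -> W) (F : M -> W) (m : M) : W :=
  tlift (fun h n => r h (F n)) (coact cM m).

Lemma convolution_linear r F : is_bilinear r -> linear F ->
  linear (convolution r F).
Proof.
move=> rb Fl; have rFb : is_bilinear (fun h n => r h (F n)).
  exact: (bilinear_comp rb (@linear_id _ _) Fl (@linear_id _ _)).
by move=> a m n; rewrite /convolution linearP tlift_linear.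
Qed.

Variable r : H -> W -> W.
Hypotheses (r_bil : is_bilinear r) (r1 : forall w, r 1 w = w).
Hypothesis rM : forall h h' w, r (h * h') w = r h (r h' w).

Local Notation S := (hopf_antipode cH).

Let S_lin : linear S. Proof. exact: linearP. Qed.

(** Coassociativity puts the first two factors of f(m_(-2)) f'(m_(-1)) F(m_(0)) under one
    comultiplication; [ff] replaces them by the counit, and counitality of M leaves F(m). The two
    antipode axioms are the instances of interest. *)
Let conv_cancel (f f' : H -> H) (F : M -> W) m :
  linear f -> linear f' -> linear F ->
  (forall h, tlift (fun h1 h2 => f h1 * f' h2) (hopf_comul cH h) =
    (hopf_counit cH h : K) *: 1) ->
  convolution (fun h => r (f h)) (convolution (fun h => r (f' h)) F) m = F m.
Proof.
move=> fl fl' Fl ff; rewrite /convolution.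
have rb (h : H) : is_bilinear (fun h' n => r (f h) (r (f' h') (F n))).
  exact: (bilinear_comp r_bil fl' Fl (r_bil.2 (f h))).
have rF0 (h : H) : is_bilinear (fun h' n => r (f' h') (F n)).
  exact: (bilinear_comp r_bil fl' Fl (@linear_id _ _)).
rewrite (eq_tlift (g := fun h n => tlift
    (fun h' n' => r (f h) (r (f' h') (F n'))) (coact cM n))); last first.
  by move=> h n; rewrite (linear_tlift _ (r_bil.2 (f h)) (rF0 h)).
rewrite coact_trilinear; last first.
  split=> // h' n; exact: linear_fun_comp fl (r_bil.1 (r (f' h') (F n))).
rewrite (eq_tlift (g := fun h n => F ((hopf_counit cH h : K) *: n))); last first.
  move=> h n; rewrite (linear_funZ _ Fl) -[X in _ *: X]r1.
  rewrite -(linear_funZ _ (r_bil.1 (F n))) -ff.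
  rewrite (linear_tlift _ (r_bil.1 (F n))).
    by apply: eq_tlift => h1 h2; rewrite rM.
  exact: (bilinear_comp (mul_bilinear H) fl fl' (@linear_id _ _)).
rewrite -(linear_tlift _ Fl) ?coact_counit //.
split=> [n a h h'|h a n n'] /=; first by rewrite linearP scalerDl scalerA.
by rewrite scalerDr !scalerA mulrC.
Qed.

Lemma convolution_antipodeK F m : linear F ->
  convolution r (convolution (fun h => r (S h)) F) m = F m.
Proof.
move=> Fl.
exact: (conv_cancel m (@linear_id _ _) S_lin Fl (hopf_antipoder cH)).
Qed.

Lemma antipode_convolutionK F m : linear F ->
  convolution (fun h => r (S h)) (convolution r F) m = F m.
Proof.
move=> Fl.
exact: (conv_cancel m S_lin (@linear_id _ _) Fl (hopf_antipodel cH)).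
Qed.

Lemma convolution_inj F F' : linear F -> linear F' ->
  convolution r F =1 convolution r F' -> F =1 F'.
Proof.
move=> Fl Fl' /funext E m.
by rewrite -(antipode_convolutionK m Fl) E antipode_convolutionK.
Qed.

End Convolution.

Section Coinvariants.
Variables (K : fieldType) (G : groupType).
Variables (beta : G -> G -> K) (beta_bichar : bicharacter beta).
Variables (H : algType K) (cH : colour_hopf_algebra beta H).

Lemma coinvariants_linear (M : lmodType K) (D : grading G M)
    (cM : comodule cH D) a m n :
  coinvariants cM m -> coinvariants cM n -> coinvariants cM (a *: m + n).
Proof.
by rewrite /coinvariants /= linearP => -> ->; rewrite (tens_bilinear _ _).2.
Qed.

Variables (A : algType K) (cA : comodule_colour_algebra cH A).

Lemma regular_act_graded g h a m :
  cA g a -> cA h m -> cA (g * h)%g (a * m).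
Proof. exact: calg_mul. Qed.

Definition regular_graded_module : graded_module cA A :=
  GradedModule (mul_bilinear A) (@mul1r A)
    (fun a b m => esym (mulrA a b m)) regular_act_graded.

(** Lets the projection onto coinvariants, defined for Hopf modules, be applied to A itself. *)
Definition regular_hopf_module : hopf_module cA A :=
  @HopfModule _ _ _ _ _ _ cA A regular_graded_module cA (cca_coactM cA).

Variables (M : lmodType K) (cM : hopf_module cA M).

(** The sign is trivial because the left leg of 1 ⊗ n has trivial degree. Hence a |-> a n is a
    colinear map from A to M. *)
Lemma coact_act_coinvariant a n : coinvariants cM n ->
  coact cM (act cM a n) = tmap idfun (fun a => act cM a n) (coact cA a).
Proof. by move=> nP; rewrite hmod_coact nP (colour_mul_1tens beta_bichar). Qed.

Lemma coinvariants_act b n : coinvariants cA b -> coinvariants cM n ->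
  coinvariants cM (act cM b n).
Proof.
move=> bP nP; rewrite /coinvariants /= coact_act_coinvariant // bP tmapE //.
exact: ((act_bilinear cM).1 n).
Qed.

End Coinvariants.

(** * The projection onto the coinvariants *)

Section CoinvariantProjection.
Variables (K : fieldType) (G : groupType).
Variables (beta : G -> G -> K) (beta_bichar : bicharacter beta).
Variables (H : algType K) (cH : colour_hopf_algebra beta H).
Variables (A : algType K) (cA : comodule_colour_algebra cH A).
Variable theta : {lrmorphism H -> A}.
Hypothesis theta_graded : graded_map cH cA theta.
Hypothesis theta_colinear : colinear (regular_comodule cH) cA theta.

Local Notation S := (hopf_antipode cH).

Let theta_lin : linear theta. Proof. exact: linearP. Qed.
Let thetaS_lin : linear (fun h => theta (S h)).
Proof. by move=> a x y; rewrite !linearP. Qed.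

Definition coinv_proj (M : lmodType K) (cM : hopf_module cA M) : M -> M :=
  convolution cM (fun h => act cM (theta (S h))) (fun m => m).

Section Module.
Variables (M : lmodType K) (cM : hopf_module cA M).

Local Notation p := (coinv_proj cM).

Let theta_act_bil : is_bilinear (fun h => act cM (theta h)).
Proof.
exact: (bilinear_comp (act_bilinear cM) theta_lin (@linear_id _ _) (@linear_id _ _)).
Qed.

Let thetaS_act_bil : is_bilinear (fun h => act cM (theta (S h))).
Proof.
exact: (bilinear_comp (act_bilinear cM) thetaS_lin (@linear_id _ _)
  (@linear_id _ _)).
Qed.

Let act_theta1 m : act cM (theta 1) m = m.
Proof. by rewrite rmorph1 act1. Qed.

Let act_thetaM h h' m :
  act cM (theta (h * h')) m = act cM (theta h) (act cM (theta h') m).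
Proof. by rewrite rmorphM actM. Qed.

Lemma coinv_proj_linear : linear p.
Proof. exact: convolution_linear thetaS_act_bil (@linear_id _ _). Qed.

Lemma coinv_proj_reconstruct m :
  convolution cM (fun h => act cM (theta h)) p m = m.
Proof.
exact: (convolution_antipodeK cM theta_act_bil act_theta1 act_thetaM m
  (@linear_id _ _)).
Qed.

(* Both sides of [coact (p m) = 1 ⊗ p m] have the same convolution product with
   [coact \o theta], which is convolution invertible. *)
Lemma coinv_projP m : coinvariants cM (p m).
Proof.
pose r h (t : H ⊗ M) := colour_mul beta cA cH *%R (act cM) (coact cA (theta h)) t.
have mul_bil := colour_mul_bilinear beta cA cH (mul_bilinear H) (act_bilinear cM).
have co_lin : linear (fun h => coact cA (theta h)) by move=> a x y; rewrite !linearP.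
have coM_lin : linear (coact cM) by exact: linearP.
have r_bil : is_bilinear r.
  exact: (bilinear_comp mul_bil co_lin (@linear_id _ _) (@linear_id _ _)).
have r1 t : r 1 t = t.
  by rewrite /r rmorph1 cca_coact1 (colour_mul1 beta_bichar).
have rM h h' t : r (h * h') t = r h (r h' t).
  by rewrite /r rmorphM cca_coactM (colour_mulA beta_bichar).
have pl := coinv_proj_linear.
have tp_lin : linear (fun m => 1 ⊗ p m : H ⊗ M).
  by move=> a x y; rewrite pl (tens_bilinear _ _).2.
suff E : (fun m => coact cM (p m)) =1 (fun m => 1 ⊗ p m) by exact: E.
apply: (@convolution_inj _ _ _ _ _ _ _ cM _ r r_bil r1 rM
  (fun m => coact cM (p m)) (fun m => 1 ⊗ p m)) => [||{}m].
- exact: linear_fun_comp pl coM_lin.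
- exact: tp_lin.
(* The first convolution is [coact] applied to the reconstruction of m; the second becomes
   [coact cM m] by colinearity of theta, coassociativity and reconstruction in the right leg. *)
transitivity (coact cM m).
  rewrite -[in RHS](coinv_proj_reconstruct m) /convolution.
  rewrite (linear_tlift _ coM_lin).
    by apply: eq_tlift => h n; rewrite hmod_coact.
  exact: (bilinear_comp theta_act_bil (@linear_id _ _) pl (@linear_id _ _)).
have rp h n : r h (1 ⊗ p n) =
    tlift (fun h1 h2 => h1 ⊗ act cM (theta h2) (p n)) (hopf_comul cH h).
  have al : linear (fun a => act cM a (p n)) := (act_bilinear cM).1 (p n).
  rewrite /r (colour_mul_1tens beta_bichar) theta_colinear /= {1}/tmap.
  rewrite (tlift_tmap _ _ theta_lin) //.
  exact: (bilinear_comp (tens_bilinear _ _) (@linear_id _ _) al (@linear_id _ _)).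
rewrite /convolution (eq_tlift rp).
have kt : trilinear (fun (h1 h2 : H) n => h1 ⊗ act cM (theta h2) (p n)).
  split=> [h1|h2 n]; last exact: ((tens_bilinear _ _).1 _).
  exact: (bilinear_comp theta_act_bil (@linear_id _ _) pl
    ((tens_bilinear _ _).2 h1)).
rewrite -(coact_trilinear cM m kt) -[LHS]tlift_tens; apply: eq_tlift => h n.
rewrite -[in LHS](coinv_proj_reconstruct n) /convolution.
rewrite (linear_tlift _ ((tens_bilinear _ _).2 h)) //.
exact: (bilinear_comp theta_act_bil (@linear_id _ _) pl (@linear_id _ _)).
Qed.

Lemma coinv_proj_graded : graded_map cM cM p.
Proof.
move=> g m /(coact_graded cM) [s [sP mE]].
rewrite /coinv_proj /convolution mE (tlift_sum _ thetaS_act_bil) big_seq.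
apply: piece_sum => x /sP[g1 [g2 [<- x1 x2]]].
by apply: act_graded => //; apply/theta_graded/hopf_antipode_graded.
Qed.

(** Since theta is colinear and n coinvariant, the coaction of theta(h) n is the sum of h_1 ⊗
    theta(h_2) n, so that p yields theta(S(h_1) h_2) n, which the antipode axiom evaluates. *)
Lemma coinv_proj_theta h n : coinvariants cM n ->
  p (act cM (theta h) n) = (hopf_counit cH h : K) *: n.
Proof.
move=> nP; rewrite /coinv_proj /convolution.
have al : linear (fun a => act cM a n) := (act_bilinear cM).1 n.
rewrite (coact_act_coinvariant beta_bichar _ nP) theta_colinear /=.
rewrite (tlift_tmap _ _ al) //; rewrite (tlift_tmap _ _ theta_lin) //; last first.
  exact: (bilinear_comp thetaS_act_bil (@linear_id _ _) al (@linear_id _ _)).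
have Sal : is_bilinear (fun h1 h2 => S h1 * h2).
  exact: (bilinear_comp (mul_bilinear H) (linearP S) (@linear_id _ _)
    (@linear_id _ _)).
have tal : linear (fun h => act cM (theta h) n) := linear_fun_comp theta_lin al.
rewrite -[X in _ *: X]act_theta1 -(linear_funZ _ tal) -hopf_antipodel.
rewrite (linear_tlift _ tal Sal).
by apply: eq_tlift => h1 h2 /=; rewrite act_thetaM.
Qed.

Lemma coinv_proj_id n : coinvariants cM n -> p n = n.
Proof.
by move=> nP; rewrite -{1}[n]act_theta1 coinv_proj_theta // hopf_counit1 scale1r.
Qed.

(** The coinvariants are the image of the graded map p, so they contain the components of their
    elements. *)
Lemma coinvariants_gcomp g n : coinvariants cM n -> coinvariants cM (gcomp cM g n).
Proof.
move=> nP; rewrite -(coinv_proj_id nP).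
rewrite (gcomp_graded _ _ coinv_proj_linear coinv_proj_graded).
exact: coinv_projP.
Qed.

(** Apply p to the right legs of a homogeneous expansion of the coaction. Linear identities thereby
    reduce to elements theta(h) n with h and n homogeneous and n coinvariant. *)
Lemma coinvariant_decomposition m : exists s : seq (H * M),
  (forall x, x \in s -> [/\ exists g, cH g x.1, exists g, cM g x.2
    & coinvariants cM x.2]) /\
  m = \sum_(x <- s) act cM (theta x.1) x.2.
Proof.
have [s [sP mE]] := tens_span_homogeneous cH cM (coact cM m).
exists [seq (x.1, p x.2) | x <- s]; split.
  move=> x /mapP[y /sP[y1 [g y2]] ->]; split=> //; last exact: coinv_projP.
  by exists g; exact: coinv_proj_graded.
rewrite big_map -[LHS]coinv_proj_reconstruct /convolution mE tlift_sum //.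
exact: (bilinear_comp theta_act_bil (@linear_id _ _) coinv_proj_linear
  (@linear_id _ _)).
Qed.

End Module.

Local Notation cAA := (regular_hopf_module cA).

Variables (M : lmodType K) (cM : hopf_module cA M).

(** For a = theta(h) b with b coinvariant, both sides equal epsilon(h) b n. *)
Lemma coinv_proj_act a n : coinvariants cM n ->
  coinv_proj cM (act cM a n) = act cM (coinv_proj cAA a) n.
Proof.
have [s [sP ->]] := coinvariant_decomposition cAA a => nP.
have al : linear (fun a => act cM a n) := (act_bilinear cM).1 n.
have pA := coinv_proj_linear cAA; have pM := coinv_proj_linear cM.
rewrite (linear_sum_fun _ _ al) (linear_sum_fun _ _ pM) (linear_sum_fun _ _ pA).
rewrite (linear_sum_fun _ _ al) !big_seq; apply: eq_bigr => x /sP[_ _ xP].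
rewrite (coinv_proj_theta _ xP) (linear_funZ _ al) /= actM coinv_proj_theta //.
exact: coinvariants_act.
Qed.

Hypothesis A_comm : colour_commutative beta cA.

(* Moving a coinvariant past [theta h] costs a sign [beta g g'] with [g'] the
   degree of [h], but [counit h = 0] unless [g' = 1]. *)
Lemma coinv_projM a m :
  coinv_proj cM (act cM a m) = act cM (coinv_proj cAA a) (coinv_proj cM m).
Proof.
have pA := coinv_proj_linear cAA; have pM := coinv_proj_linear cM.
have al n : linear (fun a => act cM a n) := (act_bilinear cM).1 n.
have ar b : linear (act cM b) := (act_bilinear cM).2 b.
have [t [tP ->]] := coinvariant_decomposition cM m.
rewrite (linear_sum_fun _ _ (ar _)) !(linear_sum_fun _ _ pM).
rewrite (linear_sum_fun _ _ (ar _)) !big_seq; apply: eq_bigr => y /tP[[g yg] _ yP].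
rewrite (coinv_proj_theta _ yP).
have [s [sP ->]] := coinvariant_decomposition cAA a.
rewrite (linear_sum_fun _ _ (al _)) (linear_sum_fun _ _ pM) (linear_sum_fun _ _ pA).
rewrite (linear_sum_fun _ _ (al _)) !big_seq; apply: eq_bigr => x /sP[_ [h xh] xP].
rewrite (coinv_proj_theta _ xP) /= -actM -mulrA (A_comm xh (theta_graded yg)).
rewrite -scalerAr mulrA -rmorphM (linear_funZ _ (al _)) (linear_funZ _ pM) actM.
rewrite coinv_proj_theta; last exact: coinvariants_act.
rewrite hopf_counitM (linear_funZ _ (al _)) (linear_funZ _ (ar _)) !scalerA.
congr (_ *: _); have [-> | ->] := hopf_counit_graded yg; last by rewrite !mulr0.
by rewrite (bichar1r beta_bichar) mul1r.
Qed.

End CoinvariantProjection.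

(** * Graded linear algebra *)

(** Finite character for the two Zorn arguments. The alternative [set0] covers an empty chain, which
    has no member to offer. *)
Lemma chain_seq (T : eqType) (F : set (set T)) (s : seq T) :
  total_on F subset -> (forall x, x \in s -> (\bigcup_(X in F) X) x) ->
  exists Z, [/\ Z = set0 \/ F Z, Z `<=` \bigcup_(X in F) X
    & forall x, x \in s -> Z x].
Proof.
move=> Ft; elim: s => [_|y s IH sF].
  by exists set0; split=> //; left.
have [x xs|Z [ZF ZU Zs]] := IH; first by apply: sF; rewrite inE xs orbT.
have [Y YF Yy] := sF y (mem_head y s).
have [YZ | ZY] : Y `<=` Z \/ Z `<=` Y.
  by case: ZF => [->|ZF]; [right | exact: Ft].
  exists Z; split=> // x; rewrite inE => /predU1P[->|/Zs//]; exact: YZ.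
exists Y; split=> [||x]; [by right | by move=> x Yx; exists Y |].
by rewrite inE => /predU1P[->|/Zs/ZY].
Qed.

Section GradedLinearAlgebra.
Variables (K : fieldType) (G : groupType) (A : algType K).
Variables (cA : colour_algebra G A) (M : lmodType K) (gM : graded_module cA M).

Local Notation "a ** m" := (act gM a m) (at level 40, left associativity).

Let actl m : linear (fun a => a ** m). Proof. exact: (act_bilinear gM).1. Qed.
Let actr a : linear (act gM a). Proof. exact: (act_bilinear gM).2. Qed.

Let actN1 m : (-1) ** m = - m.
Proof. by rewrite -[-1]scaleN1r (linear_funZ _ (actl m)) act1 scaleN1r. Qed.

(** Both B and the whole of A, as [setT], are instances, so one theory of coordinates serves for
    bases over either. *)
Definition graded_subalgebra (R : set A) : Prop :=
  [/\ R 1, forall k a b, R a -> R b -> R (k *: a + b),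
      forall a b, R a -> R b -> R (a * b)
    & forall g a, R a -> R (gcomp cA g a)].

Definition graded_submodule (R : set A) (N : set M) : Prop :=
  [/\ N 0, forall m n, N m -> N n -> N (m + n),
      forall a n, R a -> N n -> N (a ** n)
    & forall g n, N n -> N (gcomp gM g n)].

Definition homogeneous (X : set M) : Prop := forall x, X x -> exists g, gM g x.

Definition spanned (R : set A) (X : set M) (n : M) : Prop :=
  exists (s : seq M) (c : M -> A),
    [/\ forall x, x \in s -> X x, forall x, R (c x) & n = \sum_(x <- s) c x ** x].

Definition lin_indep (R : set A) (X : set M) : Prop :=
  forall (s : seq M) (c : M -> A), uniq s ->
    (forall x, x \in s -> X x) -> (forall x, R (c x)) ->
    \sum_(x <- s) c x ** x = 0 -> forall x, x \in s -> c x = 0.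

(** Unlike in [spanned], entries are distinct and coefficients vanish off the list; this makes the
    coefficient function of n unique when X is independent, which [coordinate] relies on. *)
Definition combination (R : set A) (X : set M) (n : M) (sc : seq M * (M -> A)) :
    Prop :=
  [/\ uniq sc.1, forall x, x \in sc.1 -> X x, forall x, R (sc.2 x),
      forall x, x \notin sc.1 -> sc.2 x = 0 & n = \sum_(x <- sc.1) sc.2 x ** x].

(* The coefficient of [n] at [x]; junk unless [n] is spanned by the linearly
   independent set [X]. *)
Definition coordinate (R : set A) (X : set M) (x n : M) : A :=
  (xget ([::], fun=> 0) (combination R X n)).2 x.

Lemma lin_indepS R X Y : X `<=` Y -> lin_indep R Y -> lin_indep R X.
Proof. by move=> XY Yi s c us sX; apply: Yi => // x /sX /XY. Qed.

Lemma gcomp_act g h a m : gM h m ->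
  gcomp gM g (a ** m) = gcomp cA (g * h^-1)%g a ** m.
Proof.
move=> mh; move: a.
apply: (homogeneous_ext (DU := cA) (linear_fun_comp (actl m) (gcomp_linear gM g))
  (linear_fun_comp (gcomp_linear cA (g * h^-1)%g) (actl m))) => k a ak.
rewrite (gcompE _ (act_graded ak mh)) (gcompE _ ak).
have -> : (g == (k * h)%g) = ((g * h^-1)%g == k).
  by apply/eqP/eqP=> [->|<-]; rewrite ?mulgK ?mulgVK.
by case: ifP => // _; rewrite (linear_fun0 (actl m)).
Qed.

Section Subalgebra.
Variables (R : set A) (R_sub : graded_subalgebra R).

Let R1 : R 1. Proof. by case: R_sub. Qed.
Let RL k a b : R a -> R b -> R (k *: a + b).
Proof. by case: R_sub => _ + _ _; exact. Qed.
Let RM a b : R a -> R b -> R (a * b). Proof. by case: R_sub => _ _ + _; exact. Qed.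
Let Rg g a : R a -> R (gcomp cA g a). Proof. by case: R_sub => _ _ _; exact. Qed.
Let R0 : R 0. Proof. by rewrite -(addNr 1) -scaleN1r; exact: RL. Qed.
Let RD a b : R a -> R b -> R (a + b).
Proof. by move=> Ra Rb; rewrite -[a]scale1r; exact: RL. Qed.
Let RZ k a : R a -> R (k *: a).
Proof. by move=> Ra; rewrite -[_ *: _]addr0; exact: RL. Qed.
Let RN a : R a -> R (- a). Proof. by rewrite -scaleN1r; exact: RZ. Qed.
Let Rif (b : bool) a : R a -> R (if b then a else 0). Proof. by case: b. Qed.

Lemma spanned_combination X n :
  spanned R X n -> exists sc, combination R X n sc.
Proof.
move=> [s [c [sX cR ->]]].
(* Repeated entries of [s] are merged, their coefficients adding up to a multiple of [c x]. *)
exists (undup s, fun x => if x \in s then c x *+ count_mem x s else 0).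
split=> /= [|x|x|x|]; rewrite ?undup_uniq ?mem_undup //; first exact: sX.
- by apply: Rif; elim: (count_mem x s) => // k IH; rewrite mulrS; exact: RD.
- by move=> /negPf->.
rewrite -[LHS]big_undup_iterop_count /= !big_seq.
apply: eq_bigr => x; rewrite mem_undup => xs; rewrite xs.
rewrite -/(GRing.natmul _ _); elim: (count_mem x s) => [|k IH].
  by rewrite !mulr0n (linear_fun0 (actl x)).
by rewrite !mulrS (linear_funD (actl x)) IH.
Qed.

Lemma spanned_mem (X : set M) x : X x -> spanned R X x.
Proof.
move=> Xx; exists [:: x], (fun=> 1); split=> // [y|]; last by rewrite big_seq1 act1.
by rewrite inE => /eqP->.
Qed.

Lemma combination_widen X n s c (t : seq M) : combination R X n (s, c) ->
  uniq t -> {subset s <= t} -> n = \sum_(x <- t) c x ** x.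
Proof.
move=> [/= us _ _ c0 ->] ut st; apply: big_sub_seq => // x /c0 ->.
exact: linear_fun0 (actl x).
Qed.

Lemma combination_lin X a m n s c s' c' : R a ->
  combination R X m (s, c) -> combination R X n (s', c') ->
  combination R X (a ** m + n) (undup (s ++ s'), fun x => a * c x + c' x).
Proof.
move=> Ra mE nE; have [/= us sX cR c0 _] := mE; have [/= us' sX' cR' c0' _] := nE.
split=> /= [|x|x|x|]; rewrite ?undup_uniq //.
- by rewrite mem_undup mem_cat => /orP[/sX|/sX'].
- exact/RD/cR'/RM.
- rewrite mem_undup mem_cat negb_or => /andP[/c0 -> /c0' ->].
  by rewrite mulr0 addr0.
have us2 : uniq (undup (s ++ s')) by exact: undup_uniq.
rewrite {1}(combination_widen mE us2) ; last first.
  by move=> x xs; rewrite mem_undup mem_cat xs.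
rewrite {1}(combination_widen nE us2) ; last first.
  by move=> x xs; rewrite mem_undup mem_cat xs orbT.
rewrite (linear_sum_fun _ _ (actr a)) -big_split; apply: eq_bigr => x _ /=.
by rewrite (linear_funD (actl x)) actM.
Qed.

Lemma spanned_lin X a m n : R a -> spanned R X m -> spanned R X n ->
  spanned R X (a ** m + n).
Proof.
move=> Ra /spanned_combination[[s c] mE] /spanned_combination[[s' c'] nE].
have [_ tX dR _ ->] := combination_lin Ra mE nE.
by do 2!eexists; split; [exact: tX | exact: dR |].
Qed.

Lemma spanned0 X : spanned R X 0.
Proof. by exists [::], (fun=> 0); split=> //; rewrite big_nil. Qed.

Lemma spanned_act X a m : R a -> spanned R X m -> spanned R X (a ** m).
Proof.
by move=> Ra mX; rewrite -[_ ** _]addr0; exact/spanned_lin/spanned0.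
Qed.

Lemma spannedD X m n : spanned R X m -> spanned R X n -> spanned R X (m + n).
Proof. by move=> mX nX; rewrite -[m](act1 gM); exact: spanned_lin. Qed.

Lemma spanned_sum X (I : eqType) (s : seq I) (F : I -> M) :
  (forall i, i \in s -> spanned R X (F i)) -> spanned R X (\sum_(i <- s) F i).
Proof.
move=> FX; rewrite big_seq; apply: big_ind => //.
  exact: spanned0.
exact: spannedD.
Qed.

Lemma spanned_trans X Y n :
  (forall x, X x -> spanned R Y x) -> spanned R X n -> spanned R Y n.
Proof.
move=> XY [s [c [sX cR ->]]]; apply: spanned_sum => x /sX /XY.
exact: spanned_act.
Qed.

Section Coordinates.
Variables (X : set M) (Xi : lin_indep R X).

Lemma combination_uniq n s c s' c' :
  combination R X n (s, c) -> combination R X n (s', c') -> c =1 c'.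
Proof.
move=> nE nE' x; have N1R : R (-1) by exact: RN.
have [/= ut tX dR d0 E] := combination_lin N1R nE nE'.
suff /eqP : -1 * c x + c' x = 0 by rewrite mulN1r addrC subr_eq0 => /eqP.
have [xt|/d0 //] := boolP (x \in undup (s ++ s')).
apply: (Xi (c := fun x => -1 * c x + c' x) ut) xt => //.
by rewrite -E actN1 addNr.
Qed.

Lemma coordinateE x n s c : combination R X n (s, c) -> coordinate R X x n = c x.
Proof.
move=> nE; rewrite /coordinate; case: xgetP => [[s' c'] _ nE'|/(_ (s, c))//].
exact: combination_uniq nE' nE x.
Qed.

Lemma coordinate_lin x a m n : R a -> spanned R X m -> spanned R X n ->
  coordinate R X x (a ** m + n) = a * coordinate R X x m + coordinate R X x n.
Proof.
move=> Ra /spanned_combination[[s c] mE] /spanned_combination[[s' c'] nE].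
rewrite (coordinateE x mE) (coordinateE x nE).
by rewrite (coordinateE x (combination_lin Ra mE nE)).
Qed.

Lemma coordinate0 x : coordinate R X x 0 = 0.
Proof.
by rewrite (@coordinateE x 0 [::] (fun=> 0)) //; split=> //=; rewrite big_nil.
Qed.

Lemma coordinate_act x a m : R a -> spanned R X m ->
  coordinate R X x (a ** m) = a * coordinate R X x m.
Proof.
move=> Ra mX; rewrite -[_ ** _]addr0 coordinate_lin //; last exact: spanned0.
by rewrite coordinate0 addr0.
Qed.

Lemma coordinate_linear x k m n : spanned R X m -> spanned R X n ->
  coordinate R X x (k *: m + n) =
  k *: coordinate R X x m + coordinate R X x n.
Proof.
have -> : k *: m = (k *: 1) ** m by rewrite (linear_funZ _ (actl m)) act1.
by move=> mX nX; rewrite coordinate_lin -?scalerAl ?mul1r //; exact: RZ.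
Qed.

Lemma coordinate_sum x (I : eqType) (s : seq I) (a : I -> A) (F : I -> M) :
  (forall i, R (a i)) -> (forall i, i \in s -> spanned R X (F i)) ->
  coordinate R X x (\sum_(i <- s) a i ** F i) =
  \sum_(i <- s) a i * coordinate R X x (F i).
Proof.
move=> aR; elim: s => [|i s IH] FX; first by rewrite !big_nil coordinate0.
have sX j : j \in s -> spanned R X (F j).
  by move=> js; apply: FX; rewrite inE js orbT.
rewrite !big_cons coordinate_lin ?IH //; first exact/FX/mem_head.
by apply: spanned_sum => j /sX; exact: spanned_act.
Qed.

Lemma coordinate_mem x y : X y -> coordinate R X x y = (x == y)%:R.
Proof.
move=> Xy; rewrite (@coordinateE x y [:: y] (fun x => (x == y)%:R)) //.
split=> //= [z|z|z|]; first by rewrite inE => /eqP->.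
- by case: (z == y) => //.
- by rewrite inE => /negPf->.
by rewrite big_seq1 eqxx act1.
Qed.

End Coordinates.

(** * Homogeneous bases and exchange over a colour division ring *)

Section Division.
Hypothesis R_div : colour_division_ring cA R.

(** If y has a nonzero coefficient in a relation, some component d of it, of degree k say, is
    nonzero, hence invertible in R. The component of the relation in degree k g contains d y, and
    solving for y puts it in the span of X. *)
Lemma lin_indep_extend X y g : homogeneous X -> lin_indep R X -> gM g y ->
  ~ spanned R X y -> lin_indep R (X `|` [set y]).
Proof.
move=> Xh Xi yg yX s c us sX cR s0.
have sX' x : x \in s -> x != y -> X x by move=> /sX[//|/= ->]; rewrite eqxx.
have [ys|ys] := boolP (y \in s); last first.
  by apply: Xi => // x xs; apply: sX' => //; apply: contra ys => /eqP<-.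
suff cy0 : c y = 0.
  move=> x xs; have [->//|xy] := eqVneq x y.
  apply: (Xi [seq x <- s | x != y] c); rewrite ?filter_uniq //.
  - by move=> z; rewrite mem_filter => /andP[zy zs]; exact: sX'.
  - move: s0; rewrite (bigD1_seq y) //= cy0 (linear_fun0 (actl y)) add0r.
    by rewrite big_filter.
  - by rewrite mem_filter xy.
have [_ _ ->] := decompositionP cA (c y); apply: big1 => k _.
apply: contrapT => d0; apply: yX.
have [d' Rd' [_ d'd]] := R_div (Rg k (cR y)) (gcomp_piece cA k (c y)) d0.
pose dg x := xget 1%g [set h | gM h x].
move/(congr1 (gcomp gM (k * g)%g)): s0.
rewrite (linear_sum_fun _ _ (gcomp_linear _ _)) (linear_fun0 (gcomp_linear _ _)).
rewrite (bigD1_seq y) //= (gcomp_act _ _ yg) mulgK => /(canRL (addrK _)).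
rewrite sub0r => /(congr1 (act gM d')); rewrite -actM d'd act1 => ->.
rewrite -scaleN1r (linear_funZ _ (actr d')) -(linear_funZ _ (actl _)).
apply: spanned_act; first by rewrite scaleN1r; exact: RN.
rewrite -big_filter; apply: spanned_sum => x.
rewrite mem_filter => /andP[xy xs]; have Xx := sX' x xs xy.
have [h xh] := Xh x Xx; rewrite (gcomp_act _ _ xh).
by apply: spanned_act; [exact/Rg/cR | exact: spanned_mem].
Qed.

Lemma lin_indep_bigcup (F : set (set M)) : total_on F subset ->
  (forall X, F X -> lin_indep R X) -> lin_indep R (\bigcup_(X in F) X).
Proof.
move=> Ft Fi s c us sF cR s0.
have [Z [ZF _ Zs]] := chain_seq Ft sF.
have Zi : lin_indep R Z
  by case: ZF => [->|/Fi//] [|x t] d _ // /(_ x (mem_head _ _)).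
exact: (Zi s c).
Qed.

(** If a maximal X failed to span some n, it would fail to span a homogeneous component of n, which
    lies in N and could be adjoined. *)
Lemma homogeneous_basis_exists N : graded_submodule R N ->
  graded_free gM R N.
Proof.
move=> N_sub; have [N0 ND NM Ng] := N_sub.
pose P := [set X : set M | [/\ X `<=` N, homogeneous X & lin_indep R X]].
have [F FP Ft|X [[XN Xh Xi] Xmax]] := @Zorn_bigcup M P.
  split=> [x [X XF]|x [X XF]|]; try
    by case: (FP X XF) => XN Xh _; first [exact: XN | exact: Xh].
  by apply: lin_indep_bigcup => // X /FP[].
exists X; split=> // n Nn; have [_ _ nE] := decompositionP gM n.
suff : spanned R X n by [].
rewrite nE; apply: spanned_sum => g _; apply: contrapT => gX.
apply: (Xmax (X `|` [set gcomp gM g n])).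
  split=> [|XS]; first exact: subsetUl.
  by apply/gX/spanned_mem/XS; right.
split=> [x [/XN//|->]|x [/Xh//|->]|]; first exact: Ng.
  by exists g; exact: gcomp_piece.
by apply: lin_indep_extend (gcomp_piece gM g n) gX.
Qed.

(* Exchange: [F] is the graph of an injection from a part of [X] to [Y] such
   that [X] stays independent when the part is replaced by its image. *)
Lemma lin_indep_card_le X Y : homogeneous X -> lin_indep R X -> homogeneous Y ->
  (forall x, X x -> spanned R Y x) -> (X #<= Y)%card.
Proof.
move=> Xh Xi Yh YX.
pose I (F : set (M * M)) :=
  [set z | (exists x, F (x, z)) \/ (X z /\ ~ exists y, F (z, y))].
(* The fourth condition keeps the images apart from the elements of X still to be exchanged:
   deleting such an element from [I F] deletes no image. *)
pose P := [set F : set (M * M) | [/\ forall x y, F (x, y) -> X x /\ Y y,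
  forall x y y', F (x, y) -> F (x, y') -> y = y',
  forall x x' y, F (x, y) -> F (x', y) -> x = x',
  forall x y, F (x, y) -> X y -> exists y', F (y, y')
  & lin_indep R (I F)]].
have [C CP Ct|F [[FXY Ffun Finj Fdis Find] Fmax]] := @Zorn_bigcup _ P.
  have pair u v : (\bigcup_(Z in C) Z) u -> (\bigcup_(Z in C) Z) v ->
      exists2 Z, C Z & Z u /\ Z v.
    move=> [Z CZ Zu] [Z' CZ' Zv]; have [ZZ|ZZ] := Ct Z Z' CZ CZ'.
      by exists Z' => //; split=> //; exact: ZZ.
    by exists Z => //; split=> //; exact: ZZ.
  split=> [x y [Z /CP[+ _ _ _ _]]|x y y' xy xy'|x x' y xy x'y|x y [Z CZ xy] Xy|].
  - exact.
  - have [Z /CP[_ + _ _ _] [Z1 Z2]] := pair _ _ xy xy'.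
    by apply; [exact: Z1 | exact: Z2].
  - have [Z /CP[_ _ + _ _] [Z1 Z2]] := pair _ _ xy x'y.
    by apply; [exact: Z1 | exact: Z2].
  - have [_ _ _ Zd _] := CP Z CZ; have [y' Zy'] := Zd x y xy Xy.
    by exists y', Z.
  move=> s c us sI cR s0.
  (* For each entry of [s] that is an image, [q] chooses a pair of the union. A single Z, empty or
     in the chain, contains these finitely many pairs, and an element unexchanged in the union is
     unexchanged in Z, so [s] lies in [I Z]. *)
  pose q z := xget (z, z) [set u | (\bigcup_(Z in C) Z) u /\ u.2 = z].
  have qP z x : (\bigcup_(Z in C) Z) (x, z) ->
      (\bigcup_(Z in C) Z) (q z) /\ (q z).2 = z.
    by move=> xz; rewrite /q; case: xgetP => // /(_ (x, z)) [].
  pose t := [seq q z | z <- s & `[< exists x, (\bigcup_(Z in C) Z) (x, z) >]].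
  have [u /mapP[z]|Z [ZC ZU Zt]] := @chain_seq _ C t Ct.
    by rewrite mem_filter => /andP[/asboolP[x xz] _] ->; case: (qP z x xz).
  have Zi : lin_indep R (I Z).
    case: ZC => [->|/CP[]//]; apply: (lin_indepS _ Xi) => z [[x []]|[]//].
  apply: (Zi s c) => // z zs; have [[x xz]|[Xz nz]] := sI z zs.
    left; exists (q z).1; have [_ q2] := qP z x xz.
    rewrite -[X in (_, X)]q2 -surjective_pairing.
    by apply/Zt/map_f; rewrite mem_filter zs andbT; apply/asboolP; exists x.
  by right; split=> // -[y Zy]; apply: nz; exists y; exact: ZU.
(* If x were unexchanged, the independent set [I F] without x would not span x, hence would not span
   some y in Y, as Y spans x; exchanging x for y would then enlarge F. *)
have Ftot x : X x -> exists y, F (x, y).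
  move=> Xx; apply: contrapT => xF.
  pose J := I F `\ x.
  have JI : J `<=` I F by move=> z [].
  have Jh : homogeneous J.
    by move=> z [[[x' /FXY[_ Yz]]|[Xz _]] _]; [exact: Yh | exact: Xh].
  have FJ u v : F (u, v) -> J v.
    move=> uv; split; first by left; exists u.
    by move=> /= vx; apply: xF; apply: (Fdis u x) Xx; rewrite -vx.
  have xJ : ~ spanned R J x.
    move=> /spanned_combination[[s c] [/= us sJ cR _ xE]].
    have xs : x \notin s by apply/negP => /sJ[_]; apply.
    pose c' z := if z == x then -1 else c z.
    suff /eqP : c' x = 0 by rewrite /c' eqxx oppr_eq0 oner_eq0.
    apply: (Find (x :: s) c') (mem_head x s) => [|z||]; rewrite /= ?xs //.
    - by rewrite inE => /predU1P[->|/sJ/JI//]; right.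
    - by move=> z; rewrite /c'; case: eqP => // _; exact: RN.
    rewrite big_cons {1}/c' eqxx actN1 [in X in - X + _]xE addrC.
    apply/eqP; rewrite subr_eq0; apply/eqP; rewrite !big_seq.
    apply: eq_bigr => z zs; rewrite /c'; case: eqP => // zx.
    by rewrite -zx zs in xs.
  have [y Yy yJ] : exists2 y, Y y & ~ spanned R J y.
    apply: contrapT => nY; apply: xJ; apply: spanned_trans (YX x Xx) => y Yy.
    by apply: contrapT => yJ; apply: nY; exists y.
  have yF u : ~ F (u, y) by move=> uy; apply/yJ/spanned_mem/(FJ u).
  have [g yg] := Yh y Yy.
  apply: (Fmax (F `|` [set (x, y)])).
    split=> [|FS]; first exact: subsetUl.
    by apply: xF; exists y; apply: FS; right.
  split.
  - by move=> u v [/FXY//|[-> ->]].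
  - move=> u v v' [uv|[ux ->]] [uv'|[ux' ->]] //; first exact: Ffun uv uv'.
      by case: xF; exists v; rewrite -ux'.
    by case: xF; exists v'; rewrite -ux.
  - move=> u u' v [uv|[-> vy]] [u'v|[-> vy']] //; first exact: Finj uv u'v.
      by case: (yF u); rewrite -vy'.
    by case: (yF u'); rewrite -vy.
  - move=> u v [uv|[_ ->]] Xv.
      by have [v' vv'] := Fdis _ _ uv Xv; exists v'; left.
    (* Either x is exchanged for itself, or y, being in X, was exchanged before: otherwise it would
       lie in J and be spanned by it. *)
    have [->|/eqP yx] := eqVneq y x; first by exists x; right.
    apply: contrapT => nF; apply/yJ/spanned_mem; split=> //.
    by right; split=> // -[v' vv']; apply: nF; exists v'; left.
  apply: (lin_indepS _ (lin_indep_extend Jh (lin_indepS JI Find) yg yJ)).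
  move=> z [[u [uz|[_ ->]]]|[Xz nz]]; [by left; exact: (FJ u) | by right |].
  left; split; first by right; split=> // -[v zv]; apply: nz; exists v; left.
  by move=> /= zx; apply: nz; exists y; right; rewrite zx.
pose f x := xget 0 [set y | F (x, y)].
have fP x : X x -> F (x, f x).
  by move=> /Ftot[y xy]; rewrite /f; case: xgetP => [_ _ //|/(_ y)].
have f_inj : {in X &, injective f}.
  move=> x x' /set_mem Xx /set_mem Xx' fx; apply: Finj (fP x Xx) _.
  by rewrite fx; exact: fP.
rewrite -(card_le_eql (inj_card_eq f_inj)); apply: subset_card_le.
by move=> _ [x /fP/FXY[_ Yfx] <-].
Qed.

End Division.
End Subalgebra.
End GradedLinearAlgebra.

(** * Bases of Hopf modules *)

Section ColourSimple.
Variables (K : fieldType) (G : groupType).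
Variables (beta : G -> G -> K) (beta_bichar : bicharacter beta).
Variables (H : algType K) (cH : colour_hopf_algebra beta H).
Variables (A : algType K) (cA : comodule_colour_algebra cH A).
Hypothesis A_comm : colour_commutative beta cA.

(** As b is homogeneous, coinvariant and commutes up to scalars, A b is a graded two-sided ideal and
    a subcomodule; simplicity makes it A. The component of degree g^-1 of a left inverse of b is
    then a homogeneous inverse c, and the coaction of c is found by cancelling b in that of c b =
    1. *)
Lemma colour_simple_division :
  colour_simple cA -> colour_division_ring cA (coinvariants cA).
Proof.
move=> simple g b bP bg b_neq0; have [beta_neq0 _ _] := beta_bichar.
have bl : linear (fun a => a * b) := (mul_bilinear A).1 b.
pose I := [set x | exists a, x = a * b].
have comm a : exists a', b * a = a' * b.
  have [s [c [_ cP ->]]] := piece_span cA a.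
  exists (\sum_(h <- s) beta g h *: c h); rewrite mulr_sumr mulr_suml.
  by apply: eq_bigr => h _; rewrite (A_comm bg (cP h)) scalerAl.
have I_ideal : graded_ideal cA I.
  split.
  - by exists 0; rewrite mul0r.
  - by move=> _ _ [x ->] [y ->]; exists (x + y); rewrite mulrDl.
  - by move=> a _ [x ->]; exists (a * x); rewrite mulrA.
  - move=> a _ [x ->]; have [a' E] := comm a.
    by exists (x * a'); rewrite -mulrA E mulrA.
  move=> h _ [a ->]; exists (gcomp cA (h * g^-1)%g a).
  exact: (gcomp_act (gM := regular_graded_module cA) _ _ bg).
have coact_mulb a : coact cA (a * b) = tmap idfun (fun a => a * b) (coact cA a).
  exact: (coact_act_coinvariant beta_bichar (cM := regular_hopf_module cA)).
have [x [a ->]|I0|IT] := simple I I_ideal.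
- rewrite coact_mulb; have [s ->] := tens_span (coact cA a).
  exists [seq (y.1, y.2 * b) | y <- s]; split.
    by move=> y /mapP[z _ ->]; exists z.2.
  rewrite (linear_sum_fun _ _ (tmap_linear (@linear_id _ _) bl)) big_map.
  by apply: eq_bigr => y _; rewrite tmapE.
- case: b_neq0; have : I b by exists 1; rewrite mul1r.
  by rewrite I0.
have [a /esym ab1] : I 1 by rewrite IT.
pose c := gcomp cA (1 * g^-1)%g a.
have cb1 : c * b = 1.
  have /= <- := gcomp_act (gM := regular_graded_module cA) 1%g a bg; rewrite ab1.
  by rewrite (gcompE _ (calg_one cA)) eqxx.
have bc1 : b * c = 1.
  (* Since b c = k 1, the element k^-1 c is a right inverse of b, and so agrees with the left
     inverse c. *)
  have := A_comm bg (gcomp_piece cA (1 * g^-1)%g a); rewrite -/c cb1.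
  set k := beta _ _ => bcE; have k0 : k != 0 by exact: beta_neq0.
  have bk : b * (k^-1 *: c) = 1 by rewrite -scalerAr bcE scalerA mulVf ?scale1r.
  suff <- : k^-1 *: c = c by [].
  by rewrite -[LHS]mul1r -{1}cb1 -mulrA bk mulr1.
exists c => //; rewrite /coinvariants /=.
have cl : linear (fun a => a * c) := (mul_bilinear A).1 c.
have cb t : tmap idfun (fun a => a * c) (tmap idfun (fun a => a * b) t) = t.
  move: t; apply: tensor_ext => // [|u v].
    exact: linear_fun_comp (tmap_linear (@linear_id _ _) bl)
      (tmap_linear (@linear_id _ _) cl).
  by rewrite !tmapE // -mulrA bc1 mulr1.
by rewrite -[LHS]cb -coact_mulb cb1 cca_coact1 tmapE // mul1r.
Qed.

End ColourSimple.

(** * Passing between bases over A and over its coinvariants *)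

Section CoinvariantBasis.
Variables (K : fieldType) (G : groupType).
Variables (beta : G -> G -> K) (beta_bichar : bicharacter beta).
Variables (H : algType K) (cH : colour_hopf_algebra beta H).
Variables (A : algType K) (cA : comodule_colour_algebra cH A).
Variable theta : {lrmorphism H -> A}.
Hypothesis theta_graded : graded_map cH cA theta.
Hypothesis theta_colinear : colinear (regular_comodule cH) cA theta.

Local Notation cAA := (regular_hopf_module cA).
Local Notation B := (coinvariants cA).

Lemma coinvariants_subalgebra : graded_subalgebra cA B.
Proof.
split.
- exact: cca_coact1.
- by move=> k a b; exact: coinvariants_linear.
- by move=> a b; exact: (coinvariants_act beta_bichar (cM := cAA)).
- move=> g a; exact: (coinvariants_gcomp beta_bichar theta_graded theta_colinear
    (cM := cAA)).
Qed.

Variables (M : lmodType K) (cM : hopf_module cA M).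
Local Notation N := (coinvariants cM).
Local Notation p := (coinv_proj theta cM).
Local Notation pA := (coinv_proj theta cAA).

Lemma coinvariants_submodule : graded_submodule cM B N.
Proof.
split.
- by rewrite /coinvariants /= linear0 (linear_fun0 ((tens_bilinear _ _).2 _)).
- by move=> m n mN nN; rewrite -[m]scale1r; exact: coinvariants_linear.
- by move=> a n; exact: coinvariants_act.
- by move=> g n; exact: (coinvariants_gcomp beta_bichar theta_graded theta_colinear).
Qed.

Let setT_sub : graded_subalgebra cA setT. Proof. by []. Qed.

Let pl : linear p := coinv_proj_linear theta cM.
Let pAl : linear pA := coinv_proj_linear theta cAA.
Let actl m : linear (fun a => act cM a m) := (act_bilinear cM).1 m.

Lemma coinvariant_basis_extends X :
  homogeneous_basis cM B N X -> homogeneous_basis cM setT setT X.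
Proof.
move=> [XN Xh sX Xi]; have B_sub := coinvariants_subalgebra.
split=> // [m _|s a us sX' _ s0 x xs].
  have [s [sP mE]] :=
    coinvariant_decomposition beta_bichar theta_graded theta_colinear cM m.
  suff : spanned cM setT X m by [].
  rewrite mE; apply: spanned_sum => // y /sP[_ _ yN].
  apply: spanned_act => //; have [t [c [tX _ ->]]] := sX _ yN.
  by exists t, c.
pose co n := coordinate cM B X x n.
pose q := convolution cM (fun h (a : A) => theta h * a) (fun m => co (p m)).
have pN m : N (p m) by exact: coinv_projP.
have co_lin : linear (fun m => co (p m)).
  by move=> k m n; rewrite pl /co coordinate_linear //; exact/sX/pN.
have th_lin : linear theta by exact: linearP.
have q_lin : linear q.
  apply: convolution_linear co_lin.
  exact: (bilinear_comp (mul_bilinear A) th_lin (@linear_id _ _) (@linear_id _ _)).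
(* Here b is any element of A. The right legs of the coaction of b n are the b_(0) n, and p(b_(0) n)
   = pA(b_(0)) n; the factor pA(b_(0)), being in B, leaves the coordinate, and reconstruction in A
   reassembles b from theta(b_(-1)) pA(b_(0)). *)
have q_act b n : N n -> q (act cM b n) = b * co n.
  move=> nN; rewrite /q /convolution (coact_act_coinvariant beta_bichar _ nN).
  rewrite (tlift_tmap _ _ (actl n)) //; last first.
    exact: (bilinear_comp (mul_bilinear A) th_lin co_lin (@linear_id _ _)).
  rewrite (eq_tlift (g := fun h b => (theta h * pA b) * co n)); last first.
    move=> h {}b.
    rewrite (coinv_proj_act beta_bichar theta_graded theta_colinear) //.
    rewrite /co coordinate_act ?mulrA //; last exact: sX.
    exact: (coinv_projP beta_bichar theta_colinear cAA).
  rewrite -(linear_tlift (f := fun h b => theta h * pA b) _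
    ((mul_bilinear A).1 (co n))).
    congr (_ * _); exact: (coinv_proj_reconstruct theta cAA).
  exact: (bilinear_comp (mul_bilinear A) th_lin pAl (@linear_id _ _)).
have := congr1 q s0; rewrite (linear_sum_fun _ _ q_lin) (linear_fun0 q_lin).
rewrite (bigD1_seq x) //= q_act; last exact/XN/sX'.
rewrite /co coordinate_mem //; last exact: sX'.
rewrite eqxx mulr1 big_seq_cond big1 ?addr0 // => y /andP[ys /negPf yx].
rewrite q_act; last exact/XN/sX'.
by rewrite /co coordinate_mem ?(eq_sym x) ?yx ?mulr0 //; exact: sX'.
Qed.

Hypothesis A_comm : colour_commutative beta cA.

Let pM a m : p (act cM a m) = act cM (pA a) (p m).
Proof. exact: coinv_projM. Qed.

Let pA_theta h : pA (theta h) = (hopf_counit cH h : K) *: 1.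
Proof.
rewrite -[theta h]mulr1.
apply: (coinv_proj_theta beta_bichar theta_colinear (cM := cAA)).
by case: coinvariants_subalgebra.
Qed.

(** Coordinates are A-linear, so for m = theta(h) n both sides are epsilon(h) times pA of the
    coordinate of n. In particular p(m) = 0 forces pA to kill all coordinates of m. *)
Lemma coinv_proj_coordinate X x m : homogeneous_basis cM setT setT X ->
  pA (coordinate cM setT X x (p m)) = pA (coordinate cM setT X x m).
Proof.
move=> [_ _ sX Xi].
have co_lin : linear (coordinate cM setT X x).
  by move=> k u v; rewrite coordinate_linear //; exact: sX.
have [s [sP ->]] :=
  coinvariant_decomposition beta_bichar theta_graded theta_colinear cM m.
rewrite (linear_sum_fun _ _ pl) !(linear_sum_fun _ _ co_lin).
rewrite !(linear_sum_fun _ _ pAl) !big_seq; apply: eq_bigr => y /sP[_ _ yN].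
rewrite coinv_proj_theta // (linear_funZ _ co_lin) (linear_funZ _ pAl).
rewrite coordinate_act //; last exact: sX.
have -> := coinv_projM beta_bichar theta_graded theta_colinear cAA A_comm
  (theta y.1) (coordinate cM setT X x y.2).
by rewrite pA_theta /= -scalerAl mul1r.
Qed.

Let pA_coordinate0 X x m : homogeneous_basis cM setT setT X -> p m = 0 ->
  pA (coordinate cM setT X x m) = 0.
Proof.
move=> Xb pm0; rewrite -coinv_proj_coordinate // pm0.
by case: Xb => _ _ _ Xi; rewrite coordinate0 // linear_fun0.
Qed.

(** If p(x) = p(y) with x and y distinct, then p kills x - y, whose coordinate at x is 1, while
    pA(1) = 1. *)
Lemma coinv_proj_basis_inj X : homogeneous_basis cM setT setT X ->
  {in X &, injective p}.
Proof.
move=> Xb x y /set_mem Xx /set_mem Xy pxy; apply: contrapT => /eqP /negPf xy.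
have [_ _ sX Xi] := Xb.
have /(pA_coordinate0 x Xb) : p (-1 *: y + x) = 0 by rewrite pl pxy scaleN1r addNr.
rewrite coordinate_linear ?coordinate_mem //; try exact: sX.
rewrite eqxx xy scaler0 add0r.
have -> : pA 1 = 1.
  apply: (coinv_proj_id beta_bichar theta_colinear (cM := cAA)).
  by case: coinvariants_subalgebra.
by move/eqP; rewrite oner_eq0.
Qed.

Lemma coinv_proj_basis X : homogeneous_basis cM setT setT X ->
  homogeneous_basis cM B N (p @` X).
Proof.
move=> Xb; have [_ Xh sX Xi] := Xb; have B_sub := coinvariants_subalgebra.
have pAB a : B (pA a).
  exact: (coinv_projP beta_bichar theta_colinear cAA).
split=> [_ [x _ <-]|_ [x /Xh[g xg] <-]|n nN|s c us sX' cB s0 y ys].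
- exact: coinv_projP.
- by exists g; exact: (coinv_proj_graded theta_graded (cM := cM)).
- suff : spanned cM B (p @` X) n by [].
  rewrite -(coinv_proj_id beta_bichar theta_colinear nN).
  have [s [c [sX' _ ->]]] := sX n I; rewrite (linear_sum_fun _ _ pl).
  apply: spanned_sum => // x /sX' Xx; rewrite pM.
  by apply: spanned_act => //; apply: spanned_mem => //; exists x.
(* The relation is lifted to M along preimages [e z] in X; its coefficients, lying in B, are fixed
   by pA. The lifted sum is killed by p, so pA kills its coordinate at [e y], which is [c y]. *)
pose e z := xget 0 [set x | X x /\ p x = z].
have eP z : z \in s -> X (e z) /\ p (e z) = z.
  by move=> /sX'[x Xx px]; rewrite /e; case: xgetP => [_ _ []//|/(_ x)[]].
have pAc z : pA (c z) = c z.
  exact: (coinv_proj_id beta_bichar theta_colinear (cM := cAA)).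
have /(pA_coordinate0 (e y) Xb) : p (\sum_(z <- s) act cM (c z) (e z)) = 0.
  rewrite -[RHS]s0 (linear_sum_fun _ _ pl) !big_seq.
  by apply: eq_bigr => z /eP[_ pe]; rewrite pM pAc pe.
rewrite coordinate_sum //; last by move=> z _; exact: sX.
rewrite (bigD1_seq y) //= coordinate_mem ?eqxx //; last by case: (eP y ys).
rewrite mulr1 big_seq_cond big1 ?addr0 ?pAc // => z /andP[/eP[Xez pe] zy].
rewrite coordinate_mem //; case: eqP => [E|]; last by rewrite mulr0.
by rewrite -pe -E (eP y ys).2 eqxx in zy.
Qed.

End CoinvariantBasis.

(** The first conjunct is the parenthetical example. Freeness of the coinvariants over B is stated
    too, so that the comparison of bases in [same_rank] is not vacuous. *)
Theorem corollary3p15 (K : fieldType) (G : groupType)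
    (G_abelian : forall g h : G, (g * h = h * g)%g)
    (beta : G -> G -> K) (beta_bichar : bicharacter beta)
    (H : algType K) (cH : colour_hopf_algebra beta H)
    (A : algType K) (cA : comodule_colour_algebra cH A)
    (A_comm : colour_commutative beta cA)
    (M : lmodType K) (cM : hopf_module cA M) :
  (colour_simple cA -> colour_division_ring cA (coinvariants cA)) /\
  (colour_division_ring cA (coinvariants cA) ->
   forall theta : {lrmorphism H -> A},
     graded_map cH cA theta ->
     colinear (regular_comodule cH) cA theta ->
     [/\ graded_free cM setT setT,
         graded_free cM (coinvariants cA) (coinvariants cM)
       & same_rank cM setT (coinvariants cA) setT (coinvariants cM)]).
Proof.
split=> [|B_div theta th_gr th_col]; first exact: colour_simple_division.
have B_sub := coinvariants_subalgebra beta_bichar th_gr th_col.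
have N_sub := coinvariants_submodule beta_bichar th_gr th_col cM.
have N_free := homogeneous_basis_exists B_sub B_div N_sub.
split=> // [|X X' Xb X'b].
  have [X Xb] := N_free.
  by exists X; apply: (coinvariant_basis_extends beta_bichar th_gr th_col).
have [pXN pXh pXs pXi] := coinv_proj_basis beta_bichar th_gr th_col A_comm Xb.
have [X'N X'h X's X'i] := X'b.
(* X is replaced by its image under p, a second homogeneous basis of the coinvariants over B beside
   X'; exchange bounds each of the two by the other. *)
rewrite -(card_eql (inj_card_eq
  (coinv_proj_basis_inj beta_bichar th_gr th_col A_comm Xb))).
apply: Cantor_Bernstein; apply: (lin_indep_card_le (gM := cM) B_sub B_div) => //.
- by move=> x /pXN; exact: X's.
- by move=> x /X'N; exact: pXs.
Qed.
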